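(* Let $\alpha>0$ and $y>0$. The elastic boundary-value problem $$\begin{cases}\dfrac{\partial^2 u}{\partial t^2}(x,t)=-\dfrac{1}{2^2}\dfrac{\partial^4 u}{\partial x^4}(x,t), & x>0,\ t>0,\\ u(x,0)=\delta(x-y),\\ u_t(x,0)=0,\\ \left(u_x-\alpha u\right)\big|_{x=0}=0\end{cases}$$ has solution $$\begin{aligned}u^{el}(x,t;y,0)={}&\frac{1}{\sqrt{2\pi t}}\left[\cos\left(\frac{(x-y)^2}{2t}-\frac{\pi}{4}\right)-\cos\left(\frac{(x+y)^2}{2t}-\frac{\pi}{4}\right)\right]\\&+2e^{\alpha(x+y)}\int_{x+y}^{+\infty}\frac{w\,e^{-\alpha w}}{\sqrt{2\pi t^3}}\cos\left(\frac{w^2}{2t}-\frac{3\pi}{4}\right)dw\\ ={}&\frac{1}{\sqrt{2\pi t}}\left[\cos\left(\frac{(x-y)^2}{2t}-\frac{\pi}{4}\right)+\cos\left(\frac{(x+y)^2}{2t}-\frac{\pi}{4}\right)\right]\\&-\frac{2\alpha e^{\alpha(x+y)}}{\sqrt{2\pi t}}\int_{x+y}^{\infty}e^{-\alpha w}\cos\left(\frac{w^2}{2t}-\frac{\pi}{4}\right)dw.\end{aligned}$$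
   Context: $\delta$ is the Dirac delta. The initial conditions are understood in the sense of distributions on $(0,\infty)$: as $t\to0^+$, $u(\cdot,t)\to\delta(\cdot-y)$ and $u_t(\cdot,t)\to0$. ''Has solution'' means that the displayed function satisfies the listed equation and conditions; no uniqueness class is specified. *)

(* Defs.v *)
From Stdlib Require Import Reals.
From Coquelicot Require Import Coquelicot.
Open Scope R_scope.

Definition integral_to_infty (f : R -> R) (a : R) : R :=
  RInt_gen f (at_point a) (Rbar_locally p_infty).

Definition integrable_to_infty (f : R -> R) (a : R) : Prop :=
  ex_RInt_gen f (at_point a) (Rbar_locally p_infty).

Definition dt (u : R -> R -> R) (x t : R) : R := Derive (fun s => u x s) t.
Definition dtt (u : R -> R -> R) (x t : R) : R := Derive_n (fun s => u x s) 2 t.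
Definition dx (u : R -> R -> R) (x t : R) : R := Derive (fun z => u z t) x.
Definition dxxxx (u : R -> R -> R) (x t : R) : R := Derive_n (fun z => u z t) 4 x.

(** [ex_derive_n f n] only asserts differentiability of the total function
    [Derive_n f (n-1)], so all lower orders are required too. *)
Definition pde (u : R -> R -> R) : Prop :=
  forall x t, 0 < x -> 0 < t ->
    (forall k, (k <= 2)%nat -> ex_derive_n (fun s => u x s) k t) /\
    (forall k, (k <= 4)%nat -> ex_derive_n (fun z => u z t) k x) /\
    dtt u x t = - (1 / 2 ^ 2) * dxxxx u x t.

Definition test_function (phi : R -> R) : Prop :=
  (forall n x, ex_derive_n phi n x) /\
  exists a b, 0 < a /\ a < b /\ forall x, x < a \/ b < x -> phi x = 0.

(** v(.,t) -> T in D'(0, +oo) as t -> 0+; [RInt_gen] being total, existence of the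
    pairings is required separately. *)
Definition distr_initial_value
    (v : R -> R -> R) (T : (R -> R) -> R) : Prop :=
  forall phi, test_function phi ->
    (forall t, 0 < t ->
      ex_RInt_gen (fun x => v x t * phi x)
        (at_right 0) (Rbar_locally p_infty)) /\
    filterlim
      (fun t => RInt_gen (fun x => v x t * phi x)
                  (at_right 0) (Rbar_locally p_infty))
      (at_right 0) (locally (T phi)).

Definition dirac (y : R) : (R -> R) -> R := fun phi => phi y.
Definition zero_distr : (R -> R) -> R := fun _ => 0.

(** (u_x - alpha u)|_{x=0} = 0, both for the one-sided derivative at x = 0
    and for the limit of u_x - alpha u from the interior x > 0. *)
Definition elastic_bc (alpha : R) (u : R -> R -> R) : Prop :=
  forall t, 0 < t ->
    (exists ux0 : R,
      filterlim (fun h => (u h t - u 0 t) / h) (at_right 0) (locally ux0) /\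
      ux0 - alpha * u 0 t = 0) /\
    filterlim (fun x => dx u x t - alpha * u x t) (at_right 0) (locally 0).

Definition is_elastic_solution (alpha y : R) (u : R -> R -> R) : Prop :=
  pde u /\
  distr_initial_value u (dirac y) /\
  distr_initial_value (dt u) zero_distr /\
  elastic_bc alpha u.

Definition integrand1 (alpha t w : R) : R :=
  w * exp (- (alpha * w)) / sqrt (2 * PI * t ^ 3)
    * cos (w ^ 2 / (2 * t) - 3 * PI / 4).

Definition integrand2 (alpha t w : R) : R :=
  exp (- (alpha * w)) * cos (w ^ 2 / (2 * t) - PI / 4).

Definition u_el (alpha y x t : R) : R :=
  1 / sqrt (2 * PI * t)
    * (cos ((x - y) ^ 2 / (2 * t) - PI / 4)
       - cos ((x + y) ^ 2 / (2 * t) - PI / 4))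
  + 2 * exp (alpha * (x + y))
    * integral_to_infty (integrand1 alpha t) (x + y).

Definition u_el_alt (alpha y x t : R) : R :=
  1 / sqrt (2 * PI * t)
    * (cos ((x - y) ^ 2 / (2 * t) - PI / 4)
       + cos ((x + y) ^ 2 / (2 * t) - PI / 4))
  - 2 * alpha * exp (alpha * (x + y)) / sqrt (2 * PI * t)
    * integral_to_infty (integrand2 alpha t) (x + y).

(* Main.v *)
Require Import Defs.
From Stdlib Require Import Reals Arith Lra Lia.
From Coquelicot Require Import Coquelicot.
Open Scope R_scope.

(** Write [k_th(z) = cos(z^2/2 - th) / sqrt(2 pi)] for a phase [th], and rescale it to the
    kernel [K_th(z) = q k_th(q z)] with [q = 1/sqrt t]. It is the real part of the free
    Schroedinger kernel multiplied by a unit complex number. Hence one time derivative is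
    minus half of two space derivatives with the phase advanced by [pi/2], and two time
    derivatives are minus a quarter of four space derivatives, since advancing the phase by
    [pi] changes the sign. The solution is
    [K(x - y) + K(x + y) - 2 a G(x + y)] at phase [pi/4], where
    [G(s) = e^(a s) int_s^oo e^(-a w) K(w) dw] satisfies [G' = a G - K]. Iterating this
    equation gives all space derivatives of [G], and two integrations by parts under the
    integral sign give [G] the same time rule as [K]. So the whole expression belongs to a
    family [wave n th] stable under both derivatives ([is_derive_wave_x],
    [is_derive_wave_t]), which yields the beam equation. The elastic condition at [x = 0]
    follows from [G' = a G - K] and the evenness of [K] ([wave_boundary]).

    For the initial values, [k_th] has a second primitive equal to
    [cos(th - pi/4) |z| / 2 + O(1)] ([fresnel_primitive_asymptotic]). Moving two derivatives
    onto the test function and using that the second derivative of [|x|] is twice the Dirac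
    mass gives [int K(x - p) phi(x) dx = cos(th - pi/4) phi(p) + O(sqrt t)]
    ([kernel_approximate_identity]). The reflected term is centred at [-y], outside the
    support, and [G = O(sqrt t)] by one integration by parts ([memory_decay]). At
    [th = pi/4] the limit is [phi(y)]. The velocity is [- wave 2 (3 pi/4) / 2]; its two space
    derivatives pass to [phi], and the limit is a multiple of [cos(pi/2) = 0].

    The constant is the value of the Fresnel integrals ([fresnel]). It comes from the
    identity [(int_0^x e^(i w^2/2) dw)^2 + 2 i int_0^1 e^(i x^2 (1+u^2)/2) / (1+u^2) du = i pi/2],
    whose left-hand side has derivative zero and whose second term decays
    ([fres_sq_diff], [fres_prod], [fres_aux_decay]). The two displayed formulas agree by
    integrating [(e^(-a w) K)'] over the half-line. *)

(** * Calculus on the real line *)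

(** Equations between [RInt]s live in the carrier of a normed module, which
    [ring] does not recognise as [R]. *)
Ltac as_R := apply Rminus_diag_uniq.

Lemma is_derive_continuous (f : R -> R) (x l : R) :
  is_derive f x l -> continuous f x.
Proof. intros H; apply (ex_derive_continuous f); now exists l. Qed.

Lemma ex_RInt_cont (f : R -> R) (a b : R) :
  (forall x, continuous f x) -> ex_RInt f a b.
Proof. intros H; apply (@ex_RInt_continuous R_CompleteNormedModule); auto. Qed.

Lemma RInt_plus_cont (f g : R -> R) (a b : R) :
  (forall x, continuous f x) -> (forall x, continuous g x) ->
  RInt (fun x => f x + g x) a b = RInt f a b + RInt g a b.
Proof. intros; apply (RInt_plus f g); apply ex_RInt_cont; auto. Qed.

Lemma RInt_scal_cont (f : R -> R) (k a b : R) :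
  (forall x, continuous f x) -> RInt (fun x => k * f x) a b = k * RInt f a b.
Proof. intros; apply (RInt_scal f); apply ex_RInt_cont; auto. Qed.

Lemma RInt_Chasles_cont (f : R -> R) (a b c : R) :
  (forall x, continuous f x) -> RInt f a c = RInt f a b + RInt f b c.
Proof. intros; symmetry; apply (RInt_Chasles f); apply ex_RInt_cont; auto. Qed.

Lemma RInt_of_derive (F f : R -> R) (a b : R) :
  (forall x, Rmin a b <= x <= Rmax a b -> is_derive F x (f x)) ->
  (forall x, Rmin a b <= x <= Rmax a b -> continuous f x) ->
  RInt f a b = F b - F a.
Proof.
intros HF Hf.
apply (@is_RInt_unique R_CompleteNormedModule).
now apply (@is_RInt_derive R_CompleteNormedModule F f).
Qed.

Lemma RInt_parts (f f' g g' : R -> R) (a b : R) :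
  (forall x, is_derive f x (f' x)) -> (forall x, is_derive g x (g' x)) ->
  (forall x, continuous f' x) -> (forall x, continuous g' x) ->
  RInt (fun x => f' x * g x) a b
  = f b * g b - f a * g a - RInt (fun x => f x * g' x) a b.
Proof.
intros Hf Hg Hf' Hg'.
assert (cf : forall x, continuous f x) by (intro; eapply is_derive_continuous; auto).
assert (cg : forall x, continuous g x) by (intro; eapply is_derive_continuous; auto).
assert (c1 : forall x, continuous (fun x => f' x * g x) x)
  by (intro; apply (continuous_mult f' g); auto).
assert (c2 : forall x, continuous (fun x => f x * g' x) x)
  by (intro; apply (continuous_mult f g'); auto).
assert (E : RInt (fun x => f' x * g x + f x * g' x) a b = f b * g b - f a * g a).
{ apply (RInt_of_derive (fun x => f x * g x)).
  - intros x _; apply (is_derive_mult f g); auto; intros; apply Rmult_comm.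
  - intros x _; apply (continuous_plus (fun x => f' x * g x)); auto. }
rewrite <- E.
rewrite (RInt_plus_cont (fun x => f' x * g x) (fun x => f x * g' x)) by auto.
as_R; ring.
Qed.

Lemma RInt_abs_le (f g : R -> R) (a b : R) :
  a <= b -> (forall x, continuous f x) -> (forall x, continuous g x) ->
  (forall x, a <= x <= b -> Rabs (f x) <= g x) ->
  Rabs (RInt f a b) <= RInt g a b.
Proof.
intros ab Hf Hg H.
apply (@norm_RInt_le R_NormedModule f g a b); auto.
- apply (@RInt_correct R_CompleteNormedModule), ex_RInt_cont; auto.
- apply (@RInt_correct R_CompleteNormedModule), ex_RInt_cont; auto.
Qed.

(** Both mean value steps are taken between [x] and a point on the side of [y], so that
    one statement covers increments of either sign. *)
Lemma taylor_remainder_order_2 (f f1 f2 : R -> R) (x y M : R) :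
  (forall z, is_derive f z (f1 z)) -> (forall z, is_derive f1 z (f2 z)) ->
  (forall z, Rmin x y <= z <= Rmax x y -> Rabs (f2 z) <= M) ->
  Rabs (f y - f x - (y - x) * f1 x) <= M * (y - x) ^ 2.
Proof.
intros Hf Hf1 HM.
assert (cont : forall (g g' : R -> R), (forall z, is_derive g z (g' z)) ->
  forall z, continuity_pt g z).
{ intros g g' Hg z. apply continuity_pt_filterlim, (is_derive_continuous g z (g' z)), Hg. }
destruct (MVT_gen f x y f1) as [c [Hc Ec]]; eauto.
destruct (MVT_gen f1 x c f2) as [d [Hd Ed]]; eauto.
replace (f y - f x - (y - x) * f1 x) with (f2 d * (c - x) * (y - x)) by nra.
assert (B : Rabs (f2 d) <= M).
{ apply HM; revert Hc Hd; unfold Rmin, Rmax.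
  repeat destruct Rle_dec; lra. }
assert (C : Rabs (c - x) <= Rabs (y - x)).
{ revert Hc; unfold Rmin, Rmax, Rabs.
  repeat destruct Rle_dec; repeat destruct Rcase_abs; lra. }
rewrite !Rabs_mult, <- (Rabs_pos_eq ((y - x) ^ 2)) by apply pow2_ge_0.
rewrite <- RPow_abs.
pose proof (Rabs_pos (f2 d)); pose proof (Rabs_pos (c - x));
pose proof (Rabs_pos (y - x)).
assert (Rabs (f2 d) * Rabs (c - x) <= M * Rabs (y - x)) by
  (apply Rmult_le_compat; lra).
nra.
Qed.

(** Differentiation under the integral sign is reduced to a quadratic error bound, which is
    a property that integrates; no limit has to be exchanged with the integral. *)
Lemma is_derive_of_quadratic (f : R -> R) (x l d B : R) :
  0 < d ->
  (forall y, Rabs (y - x) < d -> Rabs (f y - f x - (y - x) * l) <= B * (y - x) ^ 2) ->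
  is_derive f x l.
Proof.
intros Hd H.
apply is_derive_Reals; intros eps Heps.
assert (HB : 0 < Rabs B + 1) by (pose proof (Rabs_pos B); lra).
assert (Hm : 0 < Rmin d (eps / (Rabs B + 1))).
{ apply Rmin_pos; auto. now apply Rdiv_lt_0_compat. }
exists (mkposreal _ Hm); intros h Hh0 Hh; simpl in Hh.
assert (Hh1 : Rabs h < d) by (eapply Rlt_le_trans; [exact Hh|apply Rmin_l]).
assert (Hh2 : Rabs h < eps / (Rabs B + 1))
  by (eapply Rlt_le_trans; [exact Hh|apply Rmin_r]).
specialize (H (x + h)); replace (x + h - x) with h in H by ring.
specialize (H Hh1).
replace ((f (x + h) - f x) / h - l) with ((f (x + h) - f x - h * l) / h)
  by (field; auto).
assert (Ph : 0 < Rabs h) by (apply Rabs_pos_lt; auto).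
unfold Rdiv; rewrite Rabs_mult, Rabs_inv.
apply (Rmult_lt_reg_r (Rabs h)); auto.
rewrite Rmult_assoc, Rinv_l, Rmult_1_r by lra.
eapply Rle_lt_trans; [exact H|].
assert (E : h ^ 2 = Rabs h * Rabs h) by (rewrite <- Rabs_mult, Rabs_pos_eq; [ring|nra]).
rewrite E, <- Rmult_assoc; apply Rmult_lt_compat_r; auto.
apply Rle_lt_trans with ((Rabs B + 1) * Rabs h).
{ apply Rmult_le_compat_r; [lra|]. pose proof (Rle_abs B); lra. }
apply (Rmult_lt_compat_l (Rabs B + 1)) in Hh2; auto.
replace ((Rabs B + 1) * (eps / (Rabs B + 1))) with eps in Hh2 by (field; lra); lra.
Qed.

(** * Improper integrals *)

Lemma filterlim_abs_le (F : (R -> Prop) -> Prop) (FF : ProperFilter' F)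
    (f : R -> R) (l B : R) :
  filterlim f F (locally l) -> F (fun x => Rabs (f x) <= B) -> Rabs l <= B.
Proof.
intros Hl HB.
apply (filterlim_le (F := F) (fun x => Rabs (f x)) (fun _ => B) (Rabs l) B HB).
- apply (filterlim_comp _ _ _ f Rabs _ (locally l)); auto.
  apply (continuous_Rabs l).
- apply filterlim_const.
Qed.

(** [is_RInt_gen] as a limit of proper integrals, the form in which integrals over a
    half-line are handled below. *)
Lemma is_RInt_gen_infty (f : R -> R) (a l : R) :
  (forall x, continuous f x) ->
  is_RInt_gen f (at_point a) (Rbar_locally p_infty) l <->
  filterlim (fun b => RInt f a b) (Rbar_locally p_infty) (locally l).
Proof.
intros Hf; split; intros H.
- apply filterlim_locally; intros eps.
  apply (proj1 (filterlimi_locally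
    (F := filter_prod (at_point a) (Rbar_locally p_infty)) _ _)) with (eps := eps) in H.
  destruct H as [Q S HQ HS HP].
  apply filter_imp with (2 := HS); intros b Hb.
  destruct (HP a b HQ Hb) as [z [Hz Hbz]].
    simpl in Hz; apply (@is_RInt_unique R_CompleteNormedModule) in Hz; now rewrite Hz.
- apply (filterlimi_locally (F := filter_prod (at_point a) (Rbar_locally p_infty))).
  intros eps.
  apply filterlim_locally with (eps := eps) in H.
  exists (fun x => x = a) (fun b => ball l eps (RInt f a b)); auto.
  + reflexivity.
  + intros x b -> Hb; exists (RInt f a b); split; auto.
    apply (@RInt_correct R_CompleteNormedModule), ex_RInt_cont; auto.
Qed.

Lemma RInt_exp_neg (b M a c : R) :
  b <> 0 -> RInt (fun w => M * exp (- (b * w))) a c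
            = M / b * (exp (- (b * a)) - exp (- (b * c))).
Proof.
intros Hb.
rewrite (RInt_of_derive (fun w => - (M / b) * exp (- (b * w)))); [as_R; ring| |].
- intros x _; auto_derive; auto. field; auto.
- intros x _; apply (ex_derive_continuous (fun w => M * exp (- (b * w)))); auto_derive; auto.
Qed.

Lemma continuous_exp_neg (b M x : R) : continuous (fun w => M * exp (- (b * w))) x.
Proof. apply (ex_derive_continuous (fun w => M * exp (- (b * w)))); auto_derive; auto. Qed.

Lemma RInt_dominated (f : R -> R) (a b M c d : R) :
  (forall x, continuous f x) -> 0 < b ->
  (forall w, a <= w -> Rabs (f w) <= M * exp (- (b * w))) ->
  a <= c <= d ->
  Rabs (RInt f c d) <= M / b * exp (- (b * c)).
Proof.
intros Hf Hb HM Hcd.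
eapply Rle_trans.
- apply (RInt_abs_le f (fun w => M * exp (- (b * w)))); try lra; auto.
  + intros; apply continuous_exp_neg.
  + intros; apply HM; lra.
- rewrite RInt_exp_neg by lra.
  assert (0 <= M / b * exp (- (b * d))); [|lra].
  assert (HMp : 0 <= M * exp (- (b * d)))
    by (eapply Rle_trans; [apply Rabs_pos|apply HM; lra]).
  unfold Rdiv. replace (M * / b * exp (- (b * d))) with (M * exp (- (b * d)) * / b) by ring.
  apply Rmult_le_pos; auto. left; now apply Rinv_0_lt_compat.
Qed.

(** Cauchy criterion: the integral over [c, d] is at most [M / b exp (- b c)], and
    [exp (b c) > b c] makes this smaller than [eps] beyond [M / (eps b^2)]. *)
Lemma ex_RInt_gen_dominated (f : R -> R) (a b M : R) :
  (forall x, continuous f x) -> 0 < b ->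
  (forall w, a <= w -> Rabs (f w) <= M * exp (- (b * w))) ->
  ex_RInt_gen f (at_point a) (Rbar_locally p_infty).
Proof.
intros Hf Hb HM.
assert (HMp : 0 <= M).
{ specialize (HM a (Rle_refl a)).
  pose proof (Rabs_pos (f a)); pose proof (exp_pos (- (b * a))); nra. }
destruct (proj1 (filterlim_locally_cauchy (U := R_CompleteSpace) (F := Rbar_locally p_infty)
  (fun c => RInt f a c))) as [l Hl].
2: { exists l; apply is_RInt_gen_infty; auto. }
intros eps.
set (N := Rmax a (M / (eps * b * b))).
assert (tail : forall c d, N < c <= d -> Rabs (RInt f c d) < eps).
{ intros c d Hcd.
  assert (Hc1 : a < c) by (eapply Rle_lt_trans; [apply Rmax_l|apply Hcd]).
  assert (Hc2 : M / (eps * b * b) < c) by (eapply Rle_lt_trans; [apply Rmax_r|apply Hcd]).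
  eapply Rle_lt_trans; [apply (RInt_dominated f a b M); auto; lra|].
  assert (E : 0 < eps) by apply cond_pos.
  assert (Hc0 : 0 < c).
  { eapply Rle_lt_trans; [|exact Hc2].
    apply Rmult_le_pos; auto; left; apply Rinv_0_lt_compat.
    repeat apply Rmult_lt_0_compat; auto. }
  rewrite exp_Ropp.
  assert (bc : b * c < exp (b * c)).
  { assert (0 < b * c) by nra. pose proof (exp_ineq1 (b * c)); lra. }
  assert (P : 0 < b * c) by nra.
  apply Rle_lt_trans with (M / b * / (b * c)).
  - apply Rmult_le_compat_l.
    + apply Rmult_le_pos; auto; left; now apply Rinv_0_lt_compat.
    + apply Rinv_le_contravar; lra.
  - apply (Rmult_lt_compat_r (eps * b * b)) in Hc2;
      [|repeat apply Rmult_lt_0_compat; auto].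
    replace (M / (eps * b * b) * (eps * b * b)) with M in Hc2 by (field; lra).
    apply (Rmult_lt_reg_r (b * (b * c))); [nra|].
    replace (M / b * / (b * c) * (b * (b * c))) with M by (field; lra).
    replace (eps * (b * (b * c))) with (c * (eps * b * b)) by ring; exact Hc2. }
exists (fun c => N < c); split; [now exists N|].
assert (sym : forall c d, N < c -> c <= d -> Rabs (RInt f a d - RInt f a c) < eps).
{ intros c d Hc Hcd.
  rewrite (RInt_Chasles_cont f a c d) by auto.
  replace (RInt f a c + RInt f c d - RInt f a c) with (RInt f c d) by (as_R; ring).
  apply tail; lra. }
intros c d Hc Hd.
destruct (Rle_lt_dec c d).
- apply sym; auto.
- apply ball_sym, sym; auto; lra.
Qed.

Lemma RInt_gen_dominated (f : R -> R) (a b M : R) :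
  (forall x, continuous f x) -> 0 < b ->
  (forall w, a <= w -> Rabs (f w) <= M * exp (- (b * w))) ->
  Rabs (RInt_gen f (at_point a) (Rbar_locally p_infty)) <= M / b * exp (- (b * a)).
Proof.
intros Hf Hb HM.
pose proof (RInt_gen_correct (V := R_CompleteNormedModule) f
  (ex_RInt_gen_dominated f a b M Hf Hb HM)) as H.
apply is_RInt_gen_infty in H; auto.
eapply filterlim_abs_le; [|exact H|].
- apply Proper_StrongProper, Rbar_locally_filter.
- exists a; intros x Hx; apply (RInt_dominated f a b M); auto; lra.
Qed.

Lemma is_RInt_gen_antiderivative (F f : R -> R) (a : R) :
  (forall x, is_derive F x (f x)) -> (forall x, continuous f x) ->
  filterlim F (Rbar_locally p_infty) (locally 0) ->
  is_RInt_gen f (at_point a) (Rbar_locally p_infty) (- F a).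
Proof.
intros HF Hf Hlim.
apply is_RInt_gen_infty; auto.
apply filterlim_ext with (fun b => F b - F a).
- intros b; symmetry; apply RInt_of_derive; auto.
- apply (filterlim_comp _ _ _ F (fun z => z - F a) _ (locally 0)); auto.
  replace (- F a) with (0 - F a) by ring.
  apply (ex_derive_continuous (fun z => z - F a) 0); auto_derive; auto.
Qed.

Lemma filterlim_infty_0 (F : R -> R) (C a : R) :
  (forall x, a < x -> Rabs (F x) <= C / x) ->
  filterlim F (Rbar_locally p_infty) (locally 0).
Proof.
intros H; apply filterlim_locally; intros eps.
pose proof (cond_pos eps) as He.
exists (Rmax a (Rmax 0 (C / eps))); intros x Hx.
assert (Hx1 : a < x) by (eapply Rle_lt_trans; [apply Rmax_l|exact Hx]).
assert (Hx2 : Rmax 0 (C / eps) < x) by (eapply Rle_lt_trans; [apply Rmax_r|exact Hx]).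
assert (Hx3 : 0 < x) by (eapply Rle_lt_trans; [apply Rmax_l|exact Hx2]).
assert (Hx4 : C / eps < x) by (eapply Rle_lt_trans; [apply Rmax_r|exact Hx2]).
change (Rabs (F x - 0) < eps); rewrite Rminus_0_r.
eapply Rle_lt_trans; [apply H; auto|].
apply (Rmult_lt_compat_r eps) in Hx4; auto.
replace (C / eps * eps) with C in Hx4 by (field; lra).
apply (Rmult_lt_reg_r x); auto.
replace (C / x * x) with C by (field; lra). lra.
Qed.

(** * Fresnel integrals *)

(** A free phase [th] treats the cosine and sine integrals at once. *)
Definition osc (th w : R) : R := cos (w ^ 2 / 2 - th).
Definition fres (th z : R) : R := RInt (osc th) 0 z.

Lemma continuous_osc (th w : R) : continuous (osc th) w.
Proof. apply (ex_derive_continuous (osc th)); unfold osc; auto_derive; auto. Qed.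

Lemma osc_abs (th w : R) : Rabs (osc th w) <= 1.
Proof. apply Rabs_le, COS_bound. Qed.

Lemma is_derive_fres (th z : R) : is_derive (fres th) z (osc th z).
Proof.
apply (is_derive_RInt (V := R_NormedModule) (osc th) (fres th) 0).
- apply filter_forall; intros b.
  apply (@RInt_correct R_CompleteNormedModule), ex_RInt_cont, continuous_osc.
- apply continuous_osc.
Qed.

Lemma fres_0 (th : R) : fres th 0 = 0.
Proof. unfold fres; now rewrite RInt_point. Qed.

Lemma constant_of_derive_0 (f : R -> R) (a b : R) :
  (forall x, is_derive f x 0) -> f a = f b.
Proof.
intros H; destruct (MVT_gen f a b (fun _ => 0)) as [c [_ Hc]]; auto; [|lra].
intros x _; apply continuity_pt_filterlim, (is_derive_continuous f x 0); auto.
Qed.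

Lemma fres_odd (th z : R) : fres th (- z) = - fres th z.
Proof.
enough (E : fres th z + fres th (- z) = 0) by lra.
rewrite (constant_of_derive_0 (fun z => fres th z + fres th (- z)) z 0).
- rewrite Ropp_0, fres_0; ring.
- intros x.
  replace 0 with (plus (osc th x) (scal (-1) (osc th (- x)))).
  + apply (is_derive_plus (fres th)); [apply is_derive_fres|].
    apply (is_derive_comp (fres th) Ropp); [apply is_derive_fres|].
    auto_derive; auto.
  + unfold plus, scal; simpl; unfold mult; simpl; unfold osc.
    replace ((- x) ^ 2) with (x ^ 2) by ring. ring.
Qed.

Lemma cos_PI2_shift (x : R) : cos (x - PI / 2) = sin x.
Proof. rewrite <- cos_shift, <- cos_neg; f_equal; lra. Qed.

Lemma fres_lin (th z : R) :
  fres th z = cos th * fres 0 z + sin th * fres (PI / 2) z.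
Proof.
assert (cs : forall k om x, continuous (fun w => k * osc om w) x).
{ intros k om x; apply (continuous_scal_r k (osc om)), continuous_osc. }
unfold fres.
rewrite <- (RInt_scal_cont (osc 0)) by apply continuous_osc.
rewrite <- (RInt_scal_cont (osc (PI / 2))) by apply continuous_osc.
rewrite <- (RInt_plus_cont (fun w => cos th * osc 0 w)) by apply cs.
apply (@RInt_ext R_CompleteNormedModule); intros w _; unfold osc.
rewrite cos_PI2_shift, Rminus_0_r, cos_minus; as_R; ring.
Qed.

(** Integrating [cos (w^2/2 - th) = (sin (w^2/2 - th))' / w] by parts leaves an integrand
    bounded by [1/w^2]. *)
Lemma fres_tail (th a b : R) : 0 < a -> a <= b -> Rabs (fres th b - fres th a) <= 2 / a.
Proof.
intros Ha Hab.
set (Q := fun w => sin (w ^ 2 / 2 - th) / w).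
assert (HQ : forall w, 0 < w ->
  is_derive Q w (osc th w - sin (w ^ 2 / 2 - th) / w ^ 2)).
{ intros w Hw; unfold Q, osc; auto_derive; [lra|].
  replace (w * (w * 1) * / 2 + - th) with (w ^ 2 / 2 - th) by (field; lra).
  field; lra. }
(* With s = 1 or -1, adding s / w makes fres - Q monotone; this compares its variation
   with that of 1 / w without integrating 1 / w^2. *)
assert (D : forall s w, 0 < w ->
  is_derive (fun w => fres th w - Q w + s / w) w
    ((sin (w ^ 2 / 2 - th) - s) / w ^ 2)).
{ intros s w Hw.
  replace ((sin (w ^ 2 / 2 - th) - s) / w ^ 2) with
    (plus (minus (osc th w) (osc th w - sin (w ^ 2 / 2 - th) / w ^ 2)) (- s / w ^ 2)).
  2: { change (osc th w - (osc th w - sin (w ^ 2 / 2 - th) / w ^ 2) + - s / w ^ 2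
         = (sin (w ^ 2 / 2 - th) - s) / w ^ 2). field; lra. }
  apply (is_derive_plus (fun w => fres th w - Q w) (fun w => s / w)).
  - apply (is_derive_minus (fres th) Q); [apply is_derive_fres | auto].
  - auto_derive; [lra|field; lra]. }
assert (MV : forall s, exists c, a <= c <= b /\
  (fres th b - Q b + s / b) - (fres th a - Q a + s / a)
    = (sin (c ^ 2 / 2 - th) - s) / c ^ 2 * (b - a)).
{ intros s.
  destruct (MVT_gen (fun w => fres th w - Q w + s / w) a b
     (fun w => (sin (w ^ 2 / 2 - th) - s) / w ^ 2)) as [c Hc].
  - rewrite Rmin_left, Rmax_right by auto; intros; apply D; auto; lra.
  - rewrite Rmin_left, Rmax_right by auto; intros x Hx.
    apply continuity_pt_filterlim, (is_derive_continuous _ x _ (D s x ltac:(lra))).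
  - rewrite Rmin_left, Rmax_right in Hc by auto; exists c; exact Hc. }
assert (HQb : forall w, 0 < w -> Rabs (Q w) <= / w).
{ intros w Hw; unfold Q, Rdiv; rewrite Rabs_mult, (Rabs_pos_eq (/ w)) by
    (left; apply Rinv_0_lt_compat; auto).
  rewrite <- (Rmult_1_l (/ w)) at 2; apply Rmult_le_compat_r;
  [left; apply Rinv_0_lt_compat; auto | apply Rabs_le, SIN_bound]. }
pose proof (HQb a Ha) as Qa; pose proof (HQb b ltac:(lra)) as Qb.
apply Rabs_le_between in Qa; apply Rabs_le_between in Qb.
destruct (MV 1) as [c1 [Hc1 E1]].
destruct (MV (-1)) as [c2 [Hc2 E2]].
assert (N1 : (sin (c1 ^ 2 / 2 - th) - 1) / c1 ^ 2 * (b - a) <= 0).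
{ assert (0 < / c1 ^ 2) by (apply Rinv_0_lt_compat; nra).
  pose proof (SIN_bound (c1 ^ 2 / 2 - th)).
  unfold Rdiv at 1; assert ((1 - sin (c1 ^ 2 / 2 - th)) * / c1 ^ 2 >= 0) by
   (apply Rle_ge, Rmult_le_pos; lra). nra. }
assert (N2 : 0 <= (sin (c2 ^ 2 / 2 - th) - -1) / c2 ^ 2 * (b - a)).
{ assert (0 < / c2 ^ 2) by (apply Rinv_0_lt_compat; nra).
  pose proof (SIN_bound (c2 ^ 2 / 2 - th)).
  unfold Rdiv at 1; repeat apply Rmult_le_pos; lra. }
assert (0 < / b) by (apply Rinv_0_lt_compat; lra).
unfold Rdiv in *.
apply Rabs_le_between; lra.
Qed.

Lemma fres_bounded (th z : R) : Rabs (fres th z) <= 3.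
Proof.
assert (P : forall z, 0 <= z -> Rabs (fres th z) <= 3).
{ clear z; intros z Hz.
  assert (S : forall z, 0 <= z <= 1 -> Rabs (fres th z) <= 1).
  { clear z Hz; intros z Hz.
    eapply Rle_trans.
    - apply abs_RInt_le_const with (M := 1); [lra|apply ex_RInt_cont, continuous_osc|].
      intros; apply osc_abs.
    - lra. }
  destruct (Rle_lt_dec z 1) as [H|H].
  - pose proof (S z ltac:(lra)); lra.
  - replace (fres th z) with (fres th 1 + (fres th z - fres th 1)) by ring.
    eapply Rle_trans; [apply Rabs_triang|].
    pose proof (S 1 ltac:(lra)); pose proof (fres_tail th 1 z ltac:(lra) ltac:(lra)); lra. }
destruct (Rle_lt_dec 0 z); auto.
rewrite <- (Ropp_involutive z), fres_odd, Rabs_Ropp; apply P; lra.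
Qed.

Lemma fres_converges (th : R) :
  exists c, forall z, 0 < z -> Rabs (fres th z - c) <= 2 / z.
Proof.
destruct (proj1 (filterlim_locally_cauchy (U := R_CompleteSpace) (F := Rbar_locally p_infty)
  (fres th))) as [c Hc].
- intros eps; pose proof (cond_pos eps) as He.
  exists (fun z => 2 / eps < z); split; [now exists (2 / eps)|].
  assert (K : forall u v, 2 / eps < u -> u <= v -> Rabs (fres th v - fres th u) < eps).
  { intros u v Hu Huv.
    assert (0 < 2 / eps) by (apply Rdiv_lt_0_compat; lra).
    eapply Rle_lt_trans; [apply fres_tail; lra|].
    assert (Pu : 0 < u) by lra.
    apply (Rmult_lt_compat_r eps) in Hu; auto.
    replace (2 / eps * eps) with 2 in Hu by (field; lra).
    apply (Rmult_lt_reg_r u); [lra|].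
    replace (2 / u * u) with 2 by (field; lra); lra. }
  intros u v Hu Hv; destruct (Rle_lt_dec u v).
  + apply K; auto.
  + apply ball_sym, K; auto; lra.
- exists c; intros z Hz.
  rewrite <- Rabs_Ropp, Ropp_minus_distr.
  apply (filterlim_abs_le (Rbar_locally p_infty)) with (f := fun w => fres th w - fres th z).
  + apply Proper_StrongProper, Rbar_locally_filter.
  + apply (filterlim_comp _ _ _ (fres th) (fun u => u - fres th z) _ (locally c)); auto.
    apply (ex_derive_continuous (fun u => u - fres th z) c); auto_derive; auto.
  + exists z; intros; apply fres_tail; lra.
Qed.

(** * The value of the Fresnel integrals *)

(** The oscillating analogue of the integral [int_0^1 e^(- x^2 (1+u^2)) / (1+u^2) du] of the
    elementary evaluation of the Gaussian integral. *)
Definition fres_aux (th x : R) : R :=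
  RInt (fun u => cos (x ^ 2 * (1 + u ^ 2) / 2 - th) * / (1 + u ^ 2)) 0 1.

Lemma one_plus_sq_neq_0 (u : R) : 1 + u ^ 2 <> 0.
Proof. pose proof (pow2_ge_0 u); lra. Qed.

(** Differentiating cancels the denominator [1 + u^2]; rescaling by [w = x u] then gives back a
    Fresnel integral, [x^2/2] being absorbed into the phase. *)
Lemma is_derive_fres_aux (th x : R) :
  is_derive (fres_aux th) x (- fres (th + PI / 2 - x ^ 2 / 2) x).
Proof.
set (d := fun x u => - (x * sin (x * x * (1 + u * u) / 2 - th))).
assert (Hd : forall x u, is_derive
  (fun x => cos (x ^ 2 * (1 + u ^ 2) / 2 - th) * / (1 + u ^ 2)) x (d x u)).
{ intros z u; pose proof (one_plus_sq_neq_0 u); unfold d.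
  auto_derive; [auto|].
  replace (z * (z * 1) * (1 + u * (u * 1)) * / 2 + - th)
    with (z * z * (1 + u * u) / 2 - th) by (field; lra).
  field; simpl in *; lra. }
replace (- fres (th + PI / 2 - x ^ 2 / 2) x) with
  (RInt (fun u => Derive (fun x => cos (x ^ 2 * (1 + u ^ 2) / 2 - th) * / (1 + u ^ 2)) x) 0 1).
- apply (is_derive_RInt_param
    (fun x u => cos (x ^ 2 * (1 + u ^ 2) / 2 - th) * / (1 + u ^ 2)) 0 1 x).
  + apply filter_forall; intros z u _; eexists; apply Hd.
  + intros u _.
    apply continuity_2d_pt_ext with d.
    { intros; symmetry; apply is_derive_unique, Hd. }
    unfold d; apply continuity_2d_pt_opp, continuity_2d_pt_mult.
    * apply continuity_2d_pt_id1.
    * apply (continuity_1d_2d_pt_comp sin).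
      { apply continuity_pt_filterlim, (ex_derive_continuous sin); auto_derive; auto. }
      repeat first [apply continuity_2d_pt_minus | apply continuity_2d_pt_mult
        | apply continuity_2d_pt_plus | apply continuity_2d_pt_id1
        | apply continuity_2d_pt_id2 | apply continuity_2d_pt_const].
  + apply filter_forall; intros z; apply ex_RInt_cont; intros u.
    apply (ex_derive_continuous
      (fun u => cos (z ^ 2 * (1 + u ^ 2) / 2 - th) * / (1 + u ^ 2))).
    auto_derive; apply one_plus_sq_neq_0.
- rewrite (RInt_ext _ (fun u => d x u)) by (intros; apply is_derive_unique, Hd).
  assert (E : RInt (fun u => scal x (osc (th + PI / 2 - x ^ 2 / 2) (x * u + 0))) 0 1
     = fres (th + PI / 2 - x ^ 2 / 2) x).
  { rewrite (RInt_comp_lin (osc _)) by (apply ex_RInt_cont, continuous_osc).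
    unfold fres; f_equal; ring. }
  rewrite <- E.
  replace (- RInt (fun u => scal x (osc (th + PI / 2 - x ^ 2 / 2) (x * u + 0))) 0 1) with
    ((-1) * RInt (fun u => scal x (osc (th + PI / 2 - x ^ 2 / 2) (x * u + 0))) 0 1)
    by (as_R; ring).
  rewrite <- RInt_scal_cont.
  + apply RInt_ext; intros u _; unfold d, osc.
    change (scal x) with (Rmult x).
    replace ((x * u + 0) ^ 2 / 2 - (th + PI / 2 - x ^ 2 / 2)) with
      ((x * x * (1 + u * u) / 2 - th) - PI / 2) by field.
    rewrite cos_PI2_shift; as_R; ring.
  + intros u.
    apply (ex_derive_continuous (fun u => x * (osc (th + PI / 2 - x ^ 2 / 2) (x * u + 0)))).
    unfold osc; auto_derive; auto.
Qed.

(** The phase is stationary at the endpoint [u = 0], so dividing by its derivative is not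
    possible. But the oscillating factor has the primitive [fres (x u) / x] at a shifted
    phase, which is [O(1/x)] uniformly in [u]. *)
Lemma fres_aux_decay (th x : R) : 0 < x -> Rabs (fres_aux th x) <= 8 / x.
Proof.
intros Hx.
set (om := th - x ^ 2 / 2).
assert (Hf : forall u, is_derive (fun u => fres om (x * u) / x) u
  (cos (x ^ 2 * (1 + u ^ 2) / 2 - th))).
{ intros u.
  replace (cos (x ^ 2 * (1 + u ^ 2) / 2 - th)) with (x * osc om (x * u) * / x).
  2: { unfold osc, om; rewrite (Rmult_comm x), Rmult_assoc, Rinv_r, Rmult_1_r by lra.
       f_equal; field. }
  apply (is_derive_ext (fun u => scal (/ x) (fres om (x * u)))).
  { intros v; unfold scal; simpl; unfold mult; simpl; field; lra. }
  replace (x * osc om (x * u) * / x) with (scal (/ x) (scal x (osc om (x * u))))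
    by (unfold scal; simpl; unfold mult; simpl; ring).
  apply (is_derive_scal (fun u => fres om (x * u))).
  apply (is_derive_comp (fres om) (fun u => x * u)); [apply is_derive_fres|].
  auto_derive; auto; ring. }
assert (Hg : forall u, is_derive (fun u => / (1 + u ^ 2)) u (- (2 * u) / (1 + u ^ 2) ^ 2)).
{ intros u; pose proof (one_plus_sq_neq_0 u).
  auto_derive; [auto|]. field; simpl in *; lra. }
assert (cont2 : forall u, continuous (fun u => - (2 * u) / (1 + u ^ 2) ^ 2) u).
{ intros u; apply (ex_derive_continuous (fun u => - (2 * u) / (1 + u ^ 2) ^ 2)).
  auto_derive. pose proof (one_plus_sq_neq_0 u) as H; simpl in H.
  repeat apply Rmult_integral_contrapositive_currified; lra. }
unfold fres_aux.
rewrite (RInt_parts _ _ _ _ 0 1 Hf Hg); auto.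
2: { intros u; apply (ex_derive_continuous (fun u => cos (x ^ 2 * (1 + u ^ 2) / 2 - th))).
     auto_derive; auto. }
assert (Hb : forall u, Rabs (fres om (x * u) / x) <= 3 / x).
{ intros u; unfold Rdiv; rewrite Rabs_mult, (Rabs_pos_eq (/ x)) by
    (left; apply Rinv_0_lt_compat; auto).
  apply Rmult_le_compat_r; [left; apply Rinv_0_lt_compat; auto|apply fres_bounded]. }
assert (B1 : Rabs (RInt (fun u => fres om (x * u) / x * (- (2 * u) / (1 + u ^ 2) ^ 2)) 0 1)
  <= (1 - 0) * (3 / x * 2)).
{ apply abs_RInt_le_const; [lra| |].
  - apply ex_RInt_cont; intros u.
    apply (continuous_mult (fun u => fres om (x * u) / x)); auto.
    eapply is_derive_continuous, Hf.
  - intros u Hu; rewrite Rabs_mult; apply Rmult_le_compat; try apply Rabs_pos; auto.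
    unfold Rdiv; rewrite Rabs_mult, Rabs_Ropp, (Rabs_pos_eq (2 * u)) by lra.
    assert (1 <= (1 + u ^ 2) ^ 2) by nra.
    rewrite Rabs_pos_eq by (left; apply Rinv_0_lt_compat; lra).
    rewrite <- (Rmult_1_r 2) at 2; apply Rmult_le_compat; try lra.
    + left; apply Rinv_0_lt_compat; lra.
    + rewrite <- Rinv_1; apply Rinv_le_contravar; lra. }
pose proof (Hb 1) as B2.
rewrite (Rmult_0_r x), fres_0.
assert (0 < / x) by (apply Rinv_0_lt_compat; auto).
apply Rabs_le_between in B1; apply Rabs_le_between in B2.
apply Rabs_le_between; unfold Rdiv in *.
replace (/ (1 + 1 ^ 2)) with (/ 2) by (f_equal; ring).
lra.
Qed.

Lemma is_derive_quadratic_form (f g h : R -> R) (x f' g' h' a b c : R) :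
  is_derive f x f' -> is_derive g x g' -> is_derive h x h' ->
  is_derive (fun x => a * (f x ^ 2 - g x ^ 2) + b * (f x * g x) + c * h x) x
    (a * (2 * f x * f' - 2 * g x * g') + b * (f' * g x + f x * g') + c * h').
Proof.
intros Hf Hg Hh; auto_derive.
- repeat split; eexists; eassumption.
- assert (E : forall (k : R -> R) k', is_derive k x k' -> Derive (fun x => k x) x = k')
    by (intros; now apply is_derive_unique).
  rewrite (E f _ Hf), (E g _ Hg), (E h _ Hh); ring.
Qed.

(** Real part of the identity for [(int_0^x e^(i w^2/2) dw)^2]: both sides vanish at [0], and
    by the addition formulas ([fres_lin]) they have the same derivative. *)
Lemma fres_sq_diff (x : R) :
  fres 0 x ^ 2 - fres (PI / 2) x ^ 2 = 2 * fres_aux (PI / 2) x.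
Proof.
enough (E : fres 0 x ^ 2 - fres (PI / 2) x ^ 2 - 2 * fres_aux (PI / 2) x = 0) by lra.
rewrite (constant_of_derive_0
  (fun x => fres 0 x ^ 2 - fres (PI / 2) x ^ 2 - 2 * fres_aux (PI / 2) x) x 0).
- rewrite !fres_0; unfold fres_aux.
  rewrite (RInt_ext _ (fun _ => 0)).
  + rewrite RInt_const; unfold scal; simpl; unfold mult; simpl; ring.
  + intros u _. replace (0 ^ 2 * (1 + u ^ 2) / 2 - PI / 2) with (0 - PI / 2) by field.
    rewrite cos_PI2_shift, sin_0; as_R; ring.
- intros z.
  apply (is_derive_ext (fun x => 1 * (fres 0 x ^ 2 - fres (PI / 2) x ^ 2)
    + 0 * (fres 0 x * fres (PI / 2) x) + -2 * fres_aux (PI / 2) x)); [intros; as_R; ring|].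
  evar_last.
  + apply is_derive_quadratic_form; [apply is_derive_fres..|apply is_derive_fres_aux].
  + rewrite (fres_lin (PI / 2 + PI / 2 - z ^ 2 / 2)).
    unfold osc; rewrite cos_PI2_shift, Rminus_0_r.
    replace (PI / 2 + PI / 2 - z ^ 2 / 2) with (PI - z ^ 2 / 2) by lra.
    rewrite cos_minus, sin_minus, cos_PI, sin_PI. ring.
Qed.

(** Imaginary part of the same identity; the constant is [2 atan 1]. *)
Lemma fres_prod (x : R) :
  2 * fres 0 x * fres (PI / 2) x = PI / 2 - 2 * fres_aux 0 x.
Proof.
enough (E : 2 * fres 0 x * fres (PI / 2) x + 2 * fres_aux 0 x = PI / 2) by lra.
rewrite (constant_of_derive_0
  (fun x => 2 * fres 0 x * fres (PI / 2) x + 2 * fres_aux 0 x) x 0).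
- rewrite !fres_0; unfold fres_aux.
  rewrite (RInt_ext _ (fun u => / (1 + u ^ 2))).
  + rewrite (RInt_of_derive atan).
    * rewrite atan_0, atan_1; field.
    * intros u _; apply is_derive_Reals.
      apply derivable_pt_lim_atan.
    * intros u _; apply (ex_derive_continuous (fun u => / (1 + u ^ 2))); auto_derive.
      apply one_plus_sq_neq_0.
  + intros u _. replace (0 ^ 2 * (1 + u ^ 2) / 2 - 0) with 0 by field.
    rewrite cos_0; as_R; ring.
- intros z.
  apply (is_derive_ext (fun x => 0 * (fres 0 x ^ 2 - fres (PI / 2) x ^ 2)
    + 2 * (fres 0 x * fres (PI / 2) x) + 2 * fres_aux 0 x)); [intros; as_R; ring|].
  evar_last.
  + apply is_derive_quadratic_form; [apply is_derive_fres..|apply is_derive_fres_aux].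
  + rewrite (fres_lin (0 + PI / 2 - z ^ 2 / 2)).
    unfold osc; rewrite cos_PI2_shift, Rminus_0_r, Rplus_0_l.
    rewrite cos_shift, sin_shift. ring.
Qed.

Lemma eq_0_of_decay (a K : R) : (forall x, 1 <= x -> Rabs a <= K / x) -> a = 0.
Proof.
intros H; destruct (Req_dec a 0) as [|Ha]; auto; exfalso.
apply Rabs_pos_lt in Ha.
set (x := Rmax 1 (K / Rabs a + 1)).
pose proof (Rmax_l 1 (K / Rabs a + 1)) as H1; pose proof (Rmax_r 1 (K / Rabs a + 1)) as H2.
fold x in H1, H2; specialize (H x H1).
apply (Rmult_le_compat_r x) in H; [|lra].
replace (K / x * x) with K in H by (field; lra).
apply (Rmult_le_compat_l (Rabs a)) in H2; [|lra].
replace (Rabs a * (K / Rabs a + 1)) with (K + Rabs a) in H2 by (field; lra). lra.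
Qed.

Lemma cos_ge_quadratic (x : R) : 1 - x ^ 2 / 2 <= cos x.
Proof.
replace x with (2 * (x / 2)) at 2 by field.
rewrite cos_2a_sin.
assert (H : Rabs (sin (x / 2)) <= Rabs (x / 2)).
{ destruct (MVT_gen sin 0 (x / 2) cos) as [c [_ E]].
  - intros; apply is_derive_Reals, derivable_pt_lim_sin.
  - intros z _; apply continuity_pt_filterlim, (ex_derive_continuous sin); auto_derive; auto.
  - rewrite sin_0, !Rminus_0_r in E; rewrite E, Rabs_mult.
    assert (Rabs (cos c) <= 1) by apply Rabs_le, COS_bound.
    pose proof (Rabs_pos (x / 2)); nra. }
apply Rsqr_le_abs_1 in H; unfold Rsqr in H; nra.
Qed.

(** [fres_sq_diff] and [fres_prod] determine the limits only up to a common sign. At [17/10]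
    the bound [cos x >= 1 - x^2/2] gives [fres 0 (17/10) > 1.34], while the tail is below
    [2 / (17/10) < 1.18]. *)
Lemma fres_limit_0_pos (c : R) :
  (forall z, 0 < z -> Rabs (fres 0 z - c) <= 2 / z) -> 0 < c.
Proof.
intros Hc; specialize (Hc (17 / 10) ltac:(lra)).
assert (L : 17 / 10 - (17 / 10) ^ 5 / 40 <= fres 0 (17 / 10)).
{ replace (17 / 10 - (17 / 10) ^ 5 / 40) with (RInt (fun w => 1 - w ^ 4 / 8) 0 (17 / 10)).
  - assert (cc : forall w, continuous (fun w => 1 - w ^ 4 / 8) w)
      by (intros w; apply (ex_derive_continuous (fun w => 1 - w ^ 4 / 8)); auto_derive; auto).
    apply RInt_le; [lra|now apply ex_RInt_cont|apply ex_RInt_cont, continuous_osc|].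
    intros w _; unfold osc; rewrite Rminus_0_r.
    eapply Rle_trans; [|apply cos_ge_quadratic]. right; field.
  - rewrite (RInt_of_derive (fun w => w - w ^ 5 / 40)).
    + as_R; field.
    + intros w _; auto_derive; auto; field.
    + intros w _; apply (ex_derive_continuous (fun w => 1 - w ^ 4 / 8)); auto_derive; auto. }
apply Rabs_le_between in Hc; lra.
Qed.

Lemma cos_PI4_shift (x : R) : cos (x - PI / 4) = (cos x + sin x) / sqrt 2.
Proof.
rewrite cos_minus, cos_PI4, sin_PI4. field.
apply Rgt_not_eq, sqrt_lt_R0; lra.
Qed.

(** With [c], [s] the limits of the cosine and sine integrals, [c^2 = s^2], [2 c s = pi/2]
    and [c > 0] force [c = s = sqrt pi / 2]; other phases follow by linearity. *)
Lemma fresnel (th z : R) : 0 < z ->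
  Rabs (fres th z - sqrt (2 * PI) / 2 * cos (th - PI / 4)) <= 2 / z.
Proof.
revert z.
destruct (fres_converges 0) as [c Hc], (fres_converges (PI / 2)) as [s Hs],
  (fres_converges th) as [l Hl].
assert (Bd : forall th c, (forall z, 0 < z -> Rabs (fres th z - c) <= 2 / z) -> Rabs c <= 5).
{ intros om a Ha; specialize (Ha 1 ltac:(lra)); pose proof (fres_bounded om 1).
  replace a with (fres om 1 - (fres om 1 - a)) by ring.
  eapply Rle_trans; [apply Rabs_triang|]; rewrite Rabs_Ropp; lra. }
pose proof (Bd _ _ Hc) as Bc; pose proof (Bd _ _ Hs) as Bs.
assert (Pc := fres_limit_0_pos c Hc).
assert (inv : forall x, 1 <= x -> 0 < / x <= 1).
{ intros x Hx; split; [apply Rinv_0_lt_compat; lra|].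
  rewrite <- Rinv_1; apply Rinv_le_contravar; lra. }
assert (E1 : c ^ 2 - s ^ 2 = 0).
{ apply (eq_0_of_decay _ 48); intros x Hx.
  pose proof (fres_sq_diff x) as E.
  pose proof (fres_aux_decay (PI / 2) x ltac:(lra)) as B.
  pose proof (Hc x ltac:(lra)) as B1; pose proof (Hs x ltac:(lra)) as B2.
  pose proof (fres_bounded 0 x) as B3; pose proof (fres_bounded (PI / 2) x) as B4.
  specialize (inv x Hx); unfold Rdiv in *.
  set (C := fres 0 x) in *; set (S := fres (PI * / 2) x) in *.
  replace (c ^ 2 - s ^ 2) with
    ((c + C) * - (C - c) + (S + s) * (S - s) + 2 * fres_aux (PI * / 2) x) by (rewrite <- E; ring).
  assert (Rabs ((c + C) * - (C - c)) <= 8 * (2 * / x)).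
  { rewrite Rabs_mult, Rabs_Ropp; apply Rmult_le_compat; try apply Rabs_pos; auto.
    eapply Rle_trans; [apply Rabs_triang|]; lra. }
  assert (Rabs ((S + s) * (S - s)) <= 8 * (2 * / x)).
  { rewrite Rabs_mult; apply Rmult_le_compat; try apply Rabs_pos; auto.
    eapply Rle_trans; [apply Rabs_triang|]; lra. }
  eapply Rle_trans; [apply Rabs_triang|].
  eapply Rle_trans; [apply Rplus_le_compat_r, Rabs_triang|].
  rewrite (Rabs_mult 2), (Rabs_pos_eq 2) by lra. lra. }
assert (E2 : 2 * c * s - PI / 2 = 0).
{ apply (eq_0_of_decay _ 48); intros x Hx.
  pose proof (fres_prod x) as E.
  pose proof (fres_aux_decay 0 x ltac:(lra)) as B.
  pose proof (Hc x ltac:(lra)) as B1; pose proof (Hs x ltac:(lra)) as B2.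
  pose proof (fres_bounded 0 x) as B3; pose proof (fres_bounded (PI / 2) x) as B4.
  specialize (inv x Hx); unfold Rdiv in *.
  set (C := fres 0 x) in *; set (S := fres (PI * / 2) x) in *.
  replace (2 * c * s - PI * / 2) with
    ((- (2 * c)) * (S - s) + (- (2 * S)) * (C - c) - 2 * fres_aux 0 x).
  2: { replace (PI * / 2) with (2 * C * S + 2 * fres_aux 0 x) by (rewrite E; ring). ring. }
  assert (Rabs ((- (2 * c)) * (S - s)) <= 10 * (2 * / x)).
  { rewrite Rabs_mult; apply Rmult_le_compat; try apply Rabs_pos; auto.
    rewrite Rabs_Ropp, Rabs_mult, (Rabs_pos_eq 2) by lra; lra. }
  assert (Rabs ((- (2 * S)) * (C - c)) <= 6 * (2 * / x)).
  { rewrite Rabs_mult; apply Rmult_le_compat; try apply Rabs_pos; auto.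
    rewrite Rabs_Ropp, Rabs_mult, (Rabs_pos_eq 2) by lra; lra. }
  unfold Rminus at 1.
  eapply Rle_trans; [apply Rabs_triang|].
  eapply Rle_trans; [apply Rplus_le_compat_r, Rabs_triang|].
  rewrite Rabs_Ropp, (Rabs_mult 2), (Rabs_pos_eq 2) by lra. lra. }
assert (E3 : l - cos th * c - sin th * s = 0).
{ apply (eq_0_of_decay _ 6); intros x Hx.
  pose proof (Hc x ltac:(lra)) as B1; pose proof (Hs x ltac:(lra)) as B2.
  pose proof (Hl x ltac:(lra)) as B3.
  rewrite fres_lin in B3.
  specialize (inv x Hx); unfold Rdiv in *.
  set (C := fres 0 x) in *; set (S := fres (PI * / 2) x) in *.
  replace (l - cos th * c - sin th * s) with
    (- (cos th * C + sin th * S - l) + cos th * (C - c) + sin th * (S - s)) by ring.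
  assert (Rabs (cos th * (C - c)) <= 1 * (2 * / x)).
  { rewrite Rabs_mult; apply Rmult_le_compat; try apply Rabs_pos; auto.
    apply Rabs_le, COS_bound. }
  assert (Rabs (sin th * (S - s)) <= 1 * (2 * / x)).
  { rewrite Rabs_mult; apply Rmult_le_compat; try apply Rabs_pos; auto.
    apply Rabs_le, SIN_bound. }
  eapply Rle_trans; [apply Rabs_triang|].
  eapply Rle_trans; [apply Rplus_le_compat_r, Rabs_triang|].
  rewrite Rabs_Ropp. lra. }
assert (Es : s = c).
{ assert (F : (c - s) * (c + s) = 0) by (rewrite <- E1; ring).
  apply Rmult_integral in F; destruct F as [F|F]; [lra|].
  exfalso; assert (s = - c) by lra; subst s.
  pose proof PI_RGT_0; nra. }
subst s.
assert (Ec : c = sqrt PI / 2).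
{ apply Rsqr_inj; [lra| |].
  - pose proof (sqrt_pos PI); lra.
  - rewrite Rsqr_div', Rsqr_sqrt by (left; apply PI_RGT_0). unfold Rsqr; lra. }
replace (sqrt (2 * PI) / 2 * cos (th - PI / 4)) with l; auto.
rewrite cos_PI4_shift, sqrt_mult by (try lra; left; apply PI_RGT_0).
assert (0 < sqrt 2) by (apply sqrt_lt_R0; lra).
replace l with ((cos th + sin th) * c) by lra.
rewrite Ec; field; lra.
Qed.

(** * The kernel and its derivatives *)

(** [profile n th] is the [n]-th derivative of [cos (z^2/2 - th) / sqrt (2 pi)]. The first
    derivative is [z] times the same function at phase [th - pi/2], and Leibniz's rule for
    that product gives the recursion. In this form no polynomials have to be written out. *)
Fixpoint profile (n : nat) (th z : R) : R :=
  match n with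
  | O => osc th z / sqrt (2 * PI)
  | S m => z * profile m (th - PI / 2) z
           + match m with
             | O => 0
             | S p => INR m * profile p (th - PI / 2) z
             end
  end.

Lemma profile_SS (n : nat) (th z : R) :
  profile (S (S n)) th z
  = z * profile (S n) (th - PI / 2) z + INR (S n) * profile n (th - PI / 2) z.
Proof. reflexivity. Qed.

Lemma sqrt_2PI_ge_1 : 1 <= sqrt (2 * PI).
Proof. rewrite <- sqrt_1; apply sqrt_le_1_alt; pose proof PI2_1; lra. Qed.

Lemma is_derive_profile (n : nat) (th z : R) : is_derive (profile n th) z (profile (S n) th z).
Proof.
pose proof sqrt_2PI_ge_1 as Hs.
revert th z.
enough (H : (forall th z, is_derive (profile n th) z (profile (S n) th z)) /\
            (forall th z, is_derive (profile (S n) th) z (profile (S (S n)) th z))) by apply H.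
induction n as [|n [IH0 IH1]].
- assert (H0 : forall th z, is_derive (profile 0 th) z (profile 1 th z)).
  { intros th z; simpl; unfold osc; auto_derive; [lra|].
    replace (z ^ 2 / 2 - (th - PI / 2)) with (PI / 2 - (th - z ^ 2 / 2)) by lra.
    rewrite cos_shift, <- (Ropp_involutive (th - z ^ 2 / 2)), sin_neg.
    replace (- (th - z ^ 2 / 2)) with (z * (z * 1) * / 2 + - th) by (simpl; lra).
    field; lra. }
  split; auto; intros th z.
  apply (is_derive_ext (fun z => z * profile 0 (th - PI / 2) z)).
  { intros t; simpl; ring. }
  evar_last.
  + apply (is_derive_mult (fun z => z) (profile 0 (th - PI / 2))).
    * apply (is_derive_id z).
    * apply H0.
    * intros; apply Rmult_comm.
  + change (1 * profile 0 (th - PI / 2) z + z * profile 1 (th - PI / 2) z = profile 2 th z).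
    rewrite profile_SS; simpl (INR 1); ring.
- split; auto; intros th z.
  apply (is_derive_ext (fun z => z * profile (S n) (th - PI / 2) z
     + INR (S n) * profile n (th - PI / 2) z)); [reflexivity|].
  evar_last.
  + apply (is_derive_plus (fun z => z * profile (S n) (th - PI / 2) z)
        (fun z => INR (S n) * profile n (th - PI / 2) z)).
    * apply (is_derive_mult (fun z => z) (profile (S n) (th - PI / 2))).
      -- apply (is_derive_id z).
      -- apply IH1.
      -- intros; apply Rmult_comm.
    * apply (is_derive_scal (profile n (th - PI / 2))), IH0.
  + change ((1 * profile (S n) (th - PI / 2) z + z * profile (S (S n)) (th - PI / 2) z)
      + INR (S n) * profile (S n) (th - PI / 2) z = profile (S (S (S n))) th z).
    rewrite (profile_SS (S n) th), (S_INR (S n)); ring.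
Qed.

Lemma continuous_profile (n : nat) (th z : R) : continuous (profile n th) z.
Proof. eapply is_derive_continuous, is_derive_profile. Qed.

Lemma profile_add_PI (n : nat) (th z : R) : profile n (th + PI) z = - profile n th z.
Proof.
revert th; induction n as [n IH] using lt_wf_ind; intros th.
destruct n as [|[|n]].
- pose proof sqrt_2PI_ge_1 as Hs; simpl; unfold osc.
  replace (z ^ 2 / 2 - (th + PI)) with ((z ^ 2 / 2 - th) - PI) by ring.
  rewrite cos_minus, cos_PI, sin_PI; field; lra.
- change (z * profile 0 (th + PI - PI / 2) z + 0 = - (z * profile 0 (th - PI / 2) z + 0)).
  replace (th + PI - PI / 2) with (th - PI / 2 + PI) by lra.
  rewrite IH by lia; ring.
- rewrite !profile_SS; replace (th + PI - PI / 2) with (th - PI / 2 + PI) by lra.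
  rewrite !IH by lia; ring.
Qed.

Lemma profile_even (n : nat) (th z : R) : profile n th (- z) = (-1) ^ n * profile n th z.
Proof.
revert th; induction n as [n IH] using lt_wf_ind; intros th.
destruct n as [|[|n]].
- simpl; unfold osc; replace ((- z) ^ 2) with (z ^ 2) by ring; ring.
- change (- z * profile 0 (th - PI / 2) (- z) + 0 = (-1) ^ 1 * (z * profile 0 (th - PI / 2) z + 0)).
  rewrite IH by lia; ring.
- rewrite !profile_SS, !IH by lia. simpl pow; ring.
Qed.

Lemma profile_0_abs (th z : R) : Rabs (profile 0 th z) <= 1.
Proof.
pose proof sqrt_2PI_ge_1 as Hs; simpl.
unfold Rdiv; rewrite Rabs_mult, (Rabs_pos_eq (/ _)) by (left; apply Rinv_0_lt_compat; lra).
rewrite <- (Rmult_1_r 1); apply Rmult_le_compat.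
- apply Rabs_pos.
- left; apply Rinv_0_lt_compat; lra.
- apply osc_abs.
- rewrite <- Rinv_1; apply Rinv_le_contravar; lra.
Qed.

Lemma profile_1_abs (th z : R) : Rabs (profile 1 th z) <= Rabs z.
Proof.
change (profile 1 th z) with (z * profile 0 (th - PI / 2) z + 0).
rewrite Rplus_0_r, Rabs_mult.
pose proof (profile_0_abs (th - PI / 2) z); pose proof (Rabs_pos z); nra.
Qed.

Lemma profile_2_abs (th z : R) : Rabs (profile 2 th z) <= Rabs z ^ 2 + 1.
Proof.
rewrite profile_SS; simpl (INR 1).
eapply Rle_trans; [apply Rabs_triang|]; rewrite Rmult_1_l, Rabs_mult.
pose proof (profile_0_abs (th - PI / 2) z); pose proof (profile_1_abs (th - PI / 2) z).
pose proof (Rabs_pos z); nra.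
Qed.

Lemma profile_3_abs (th z : R) : Rabs (profile 3 th z) <= Rabs z ^ 3 + 3 * Rabs z.
Proof.
rewrite profile_SS; replace (INR 2) with 2 by (simpl; ring).
eapply Rle_trans; [apply Rabs_triang|]; rewrite !Rabs_mult, (Rabs_pos_eq 2) by lra.
pose proof (profile_1_abs (th - PI / 2) z); pose proof (profile_2_abs (th - PI / 2) z).
pose proof (Rabs_pos z); nra.
Qed.

(** The [n]-th derivative in [z] of [q * profile 0 th (q * z)]. Keeping [q = / sqrt t]
    as the parameter makes the kernel polynomial in [q] up to the cosine. *)
Definition kernel (n : nat) (th q z : R) : R := q ^ S n * profile n th (q * z).

Lemma is_derive_kernel_z (n : nat) (th q z : R) :
  is_derive (kernel n th q) z (kernel (S n) th q z).
Proof.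
unfold kernel.
replace (q ^ S (S n) * profile (S n) th (q * z)) with
  (q ^ S n * (q * profile (S n) th (q * z))) by (simpl; ring).
apply (is_derive_scal (fun z => profile n th (q * z))).
apply (is_derive_comp (profile n th) (fun z => q * z)); [apply is_derive_profile|].
auto_derive; auto; ring.
Qed.

Lemma continuous_kernel (n : nat) (th q z : R) : continuous (kernel n th q) z.
Proof. eapply is_derive_continuous, is_derive_kernel_z. Qed.

(** The recursion for [profile] read backwards: the factor [z] and the power of [q] produced
    by differentiating in [q] recombine into two further derivatives in [z]. *)
Lemma is_derive_kernel_q (n : nat) (th q z : R) :
  is_derive (fun q => kernel n th q z) q (q ^ n * profile (S (S n)) (th + PI / 2) (q * z)).
Proof.
unfold kernel.
evar_last.
- apply (is_derive_mult (fun q => q ^ S n) (fun q => profile n th (q * z))).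
  + apply is_derive_pow, (is_derive_id q).
  + apply (is_derive_comp (profile n th) (fun q => q * z)); [apply is_derive_profile|].
    auto_derive; auto.
  + intros; apply Rmult_comm.
- rewrite profile_SS; replace (th + PI / 2 - PI / 2) with th by ring.
  change (INR (S n) * 1 * q ^ Init.Nat.pred (S n) * profile n th (q * z)
    + q ^ S n * (1 * z * profile (S n) th (q * z))
    = q ^ n * (q * z * profile (S n) th (q * z) + INR (S n) * profile n th (q * z))).
  simpl Init.Nat.pred; change (q ^ S n) with (q * q ^ n); ring.
Qed.

Lemma is_derive_inv_sqrt (t : R) : 0 < t ->
  is_derive (fun t => / sqrt t) t (- (/ sqrt t) ^ 3 / 2).
Proof.
intros Ht; assert (Hs := sqrt_lt_R0 t Ht).
auto_derive; [lra|].
field; lra.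
Qed.

(** Real form of the Schroedinger equation satisfied by the complex kernel. *)
Lemma is_derive_kernel_t (n : nat) (th t z : R) : 0 < t ->
  is_derive (fun t => kernel n th (/ sqrt t) z) t
    (- (1 / 2) * kernel (S (S n)) (th + PI / 2) (/ sqrt t) z).
Proof.
intros Ht; evar_last.
- apply (is_derive_comp (fun q => kernel n th q z) (fun t => / sqrt t)).
  + apply is_derive_kernel_q.
  + now apply is_derive_inv_sqrt.
- unfold kernel; set (q := / sqrt t).
  change (- q ^ 3 / 2 * (q ^ n * profile (S (S n)) (th + PI / 2) (q * z))
    = - (1 / 2) * (q ^ S (S (S n)) * profile (S (S n)) (th + PI / 2) (q * z))).
  simpl pow; field.
Qed.

(** * The exponentially weighted integral of the kernel *)

Definition laplace (a th q s : R) : R :=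
  integral_to_infty (fun w => exp (- (a * w)) * kernel 0 th q w) s.

Lemma continuous_exp_mult (a : R) (f : R -> R) (w : R) :
  continuous f w -> continuous (fun w => exp (- (a * w)) * f w) w.
Proof.
intros H; apply (continuous_mult (fun w => exp (- (a * w))) f); auto.
apply (ex_derive_continuous (fun w => exp (- (a * w)))); auto_derive; auto.
Qed.

Lemma exp_kernel_dominated (a th q w : R) :
  Rabs (exp (- (a * w)) * kernel 0 th q w) <= Rabs q * exp (- (a * w)).
Proof.
rewrite Rabs_mult, Rmult_comm, (Rabs_pos_eq (exp _)) by (left; apply exp_pos).
apply Rmult_le_compat_r; [left; apply exp_pos|].
unfold kernel; rewrite pow_1, Rabs_mult.
pose proof (profile_0_abs th (q * w)); pose proof (Rabs_pos q); nra.
Qed.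

Lemma is_RInt_gen_laplace (a th q s : R) : 0 < a ->
  is_RInt_gen (fun w => exp (- (a * w)) * kernel 0 th q w)
    (at_point s) (Rbar_locally p_infty) (laplace a th q s).
Proof.
intros Ha; apply (RInt_gen_correct (V := R_CompleteNormedModule)).
apply (ex_RInt_gen_dominated _ s a (Rabs q)); auto.
- intros; apply continuous_exp_mult, continuous_kernel.
- intros; apply exp_kernel_dominated.
Qed.

Lemma integral_to_infty_eq (f : R -> R) (s l : R) :
  is_RInt_gen f (at_point s) (Rbar_locally p_infty) l -> integral_to_infty f s = l.
Proof. apply (is_RInt_gen_unique (V := R_CompleteNormedModule)). Qed.

Lemma is_derive_laplace_s (a th q s : R) : 0 < a ->
  is_derive (laplace a th q) s (- (exp (- (a * s)) * kernel 0 th q s)).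
Proof.
intros Ha.
set (f := fun w => exp (- (a * w)) * kernel 0 th q w).
assert (cf : forall w, continuous f w) by (intros; apply continuous_exp_mult, continuous_kernel).
apply (is_derive_ext (fun s => laplace a th q 0 - RInt f 0 s)).
- intros r; symmetry; apply integral_to_infty_eq; fold f.
  pose proof (is_RInt_gen_laplace a th q 0 Ha) as H; fold f in H.
  apply is_RInt_gen_infty; auto; apply is_RInt_gen_infty in H; auto.
  apply filterlim_ext with (fun b => RInt f 0 b - RInt f 0 r).
  { intros b; rewrite (RInt_Chasles_cont f 0 r b cf); as_R; ring. }
  apply (filterlim_comp _ _ _ (fun b => RInt f 0 b) (fun z => z - RInt f 0 r) _
    (locally (laplace a th q 0))); auto.
  apply (ex_derive_continuous (fun z => z - RInt f 0 r)); auto_derive; auto.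
- replace (- (exp (- (a * s)) * kernel 0 th q s)) with (minus 0 (f s))
    by (unfold minus, plus, opp; simpl; unfold f; ring).
  apply (is_derive_minus (fun _ => laplace a th q 0) (fun s => RInt f 0 s)).
  + apply (is_derive_const (V := R_NormedModule)).
  + apply (is_derive_RInt (V := R_NormedModule) f (fun s => RInt f 0 s) 0); auto.
    apply filter_forall; intros b.
    apply (@RInt_correct R_CompleteNormedModule), ex_RInt_cont; auto.
Qed.

Lemma one_plus_pow4_le_exp (b w : R) : 0 < b -> 0 <= w ->
  1 + w ^ 4 <= (1 + (4 / b) ^ 4) * exp (b * w).
Proof.
intros Hb Hw.
assert (H : w <= 4 / b * exp (b * w / 4)).
{ assert (b * w / 4 <= exp (b * w / 4)).
  { destruct (Req_dec (b * w / 4) 0) as [E|E].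
    - rewrite E, exp_0; lra.
    - pose proof (exp_ineq1 _ E); lra. }
  assert (P : 0 < 4 / b) by (apply Rdiv_lt_0_compat; lra).
  apply (Rmult_le_compat_l (4 / b)) in H; [|lra].
  replace (4 / b * (b * w / 4)) with w in H by (field; lra); auto. }
assert (E : exp (b * w) = exp (b * w / 4) ^ 4).
{ replace (b * w) with (b * w / 4 + b * w / 4 + (b * w / 4 + b * w / 4)) at 1 by field.
  rewrite !exp_plus; ring. }
assert (H1 : 1 <= exp (b * w)).
{ rewrite <- exp_0; destruct (Req_dec (b * w) 0) as [F|F]; [rewrite F; lra|].
  left; apply exp_increasing; assert (0 <= b * w) by (apply Rmult_le_pos; lra); lra. }
pose proof (pow_incr w (4 / b * exp (b * w / 4)) 4 (conj Hw H)) as H2.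
rewrite Rpow_mult_distr, <- E in H2; lra.
Qed.

(** Two integrations by parts in one step: [exp (-a w) (K_1 + a K_0)] is an antiderivative
    of [exp (-a w) (K_2 - a^2 K_0)]. *)
Lemma is_RInt_gen_laplace_K2 (a th q s : R) : 0 < a ->
  is_RInt_gen (fun w => exp (- (a * w)) * kernel 2 th q w)
    (at_point s) (Rbar_locally p_infty)
    (a ^ 2 * laplace a th q s - exp (- (a * s)) * (kernel 1 th q s + a * kernel 0 th q s)).
Proof.
intros Ha.
set (F := fun w => exp (- (a * w)) * (kernel 1 th q w + a * kernel 0 th q w)).
set (f := fun w => exp (- (a * w)) * (kernel 2 th q w - a ^ 2 * kernel 0 th q w)).
assert (HF : forall w, is_derive F w (f w)).
{ intros w; unfold F; evar_last.
  - apply (is_derive_mult (fun w => exp (- (a * w)))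
      (fun w => kernel 1 th q w + a * kernel 0 th q w)).
    + auto_derive; auto.
    + apply (is_derive_plus (kernel 1 th q) (fun w => a * kernel 0 th q w)).
      * apply is_derive_kernel_z.
      * apply (is_derive_scal (kernel 0 th q)), is_derive_kernel_z.
    + intros; apply Rmult_comm.
  - unfold f, plus, mult; simpl; unfold mult; simpl. ring. }
assert (cf : forall w, continuous f w).
{ intros w; apply continuous_exp_mult.
  apply (continuous_minus (kernel 2 th q) (fun w => a ^ 2 * kernel 0 th q w)).
  - apply continuous_kernel.
  - apply (continuous_scal_r (a ^ 2) (kernel 0 th q)), continuous_kernel. }
assert (lim : filterlim F (Rbar_locally p_infty) (locally 0)).
{ apply (filterlim_infty_0 F ((Rabs q ^ 3 + a * Rabs q) * (1 + (4 / a) ^ 4)) 0).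
  intros w Hw.
  pose proof (one_plus_pow4_le_exp a w Ha ltac:(lra)) as E.
  assert (B : Rabs (kernel 1 th q w + a * kernel 0 th q w) <= Rabs q ^ 3 * w + a * Rabs q).
  { unfold kernel; eapply Rle_trans; [apply Rabs_triang|].
    rewrite !Rabs_mult, <- !RPow_abs, (Rabs_pos_eq a) by lra.
    pose proof (profile_1_abs th (q * w)) as B1; pose proof (profile_0_abs th (q * w)) as B0.
    rewrite Rabs_mult, (Rabs_pos_eq w) in B1 by lra.
    pose proof (Rabs_pos q) as Pq.
    apply Rplus_le_compat.
    - replace (Rabs q ^ 3 * w) with (Rabs q ^ 2 * (Rabs q * w)) by ring.
      apply Rmult_le_compat_l; auto; apply pow_le; auto.
    - apply Rmult_le_compat_l; [lra|]. rewrite pow_1.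
      rewrite <- (Rmult_1_r (Rabs q)) at 2; apply Rmult_le_compat_l; auto. }
  unfold F; rewrite Rabs_mult, (Rabs_pos_eq (exp _)) by (left; apply exp_pos).
  rewrite exp_Ropp.
  pose proof (exp_pos (a * w)) as Pe.
  apply (Rmult_le_reg_r (w * exp (a * w))); [apply Rmult_lt_0_compat; lra|].
  replace (/ exp (a * w) * Rabs (kernel 1 th q w + a * kernel 0 th q w) * (w * exp (a * w)))
    with (Rabs (kernel 1 th q w + a * kernel 0 th q w) * w) by (field; lra).
  replace ((Rabs q ^ 3 + a * Rabs q) * (1 + (4 / a) ^ 4) / w * (w * exp (a * w)))
    with ((Rabs q ^ 3 + a * Rabs q) * ((1 + (4 / a) ^ 4) * exp (a * w))) by (field; lra).
  apply Rle_trans with ((Rabs q ^ 3 * w + a * Rabs q) * w).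
  { apply Rmult_le_compat_r; lra. }
  apply Rle_trans with ((Rabs q ^ 3 + a * Rabs q) * (1 + w ^ 4)).
  2: { apply Rmult_le_compat_l; auto.
       pose proof (Rabs_pos q); pose proof (pow_le _ 3 H).
       apply Rplus_le_le_0_compat; auto; apply Rmult_le_pos; lra. }
  pose proof (Rabs_pos q) as Pq; pose proof (pow_le _ 3 Pq) as Pq3.
  assert (Paq : 0 <= a * Rabs q) by (apply Rmult_le_pos; lra).
  assert (W2 : w * w <= 1 + w ^ 4) by nra.
  assert (W1 : w <= 1 + w ^ 4) by nra.
  apply (Rmult_le_compat_l _ _ _ Pq3) in W2; apply (Rmult_le_compat_l _ _ _ Paq) in W1.
  lra. }
pose proof (is_RInt_gen_antiderivative F f s HF cf lim) as H1.
pose proof (is_RInt_gen_scal _ (a ^ 2) _ (is_RInt_gen_laplace a th q s Ha)) as H2.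
pose proof (is_RInt_gen_plus _ _ _ _ H1 H2) as H.
replace (a ^ 2 * laplace a th q s - exp (- (a * s)) * (kernel 1 th q s + a * kernel 0 th q s))
  with (plus (- F s) (scal (a ^ 2) (laplace a th q s)))
  by (unfold plus, scal; simpl; unfold mult; simpl; unfold F; ring).
apply is_RInt_gen_ext with (2 := H).
apply filter_forall; intros ab w _.
unfold plus, scal; simpl; unfold mult; simpl; unfold f; ring.
Qed.

(** Differentiation under the integral sign: the second-order Taylor remainder in [q] is
    of order [w^4], which half of the exponential absorbs, and the other half keeps the
    remainder integrable. [is_RInt_gen_laplace_K2] gives the derivative in closed form. *)
Lemma is_derive_laplace_q (a th q s : R) : 0 < a -> 0 < q -> 0 <= s ->
  is_derive (fun q => laplace a th q s) q
    ((a ^ 2 * laplace a (th + PI / 2) q s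
      - exp (- (a * s)) * (kernel 1 (th + PI / 2) q s + a * kernel 0 (th + PI / 2) q s)) / q ^ 3).
Proof.
intros Ha Hq Hs.
set (L := _ / q ^ 3).
(* The increment r - q is kept below q in absolute value, hence |r| <= Q. *)
set (Q := 2 * q).
set (C := (Q ^ 3 + 3 * Q) * (1 + (4 / (a / 2)) ^ 4)).
apply (is_derive_of_quadratic _ q L q (C / (a / 2) * exp (- (a / 2 * s))) Hq).
intros r Hr.
assert (HL : is_RInt_gen (fun w => exp (- (a * w)) * profile 2 (th + PI / 2) (q * w))
    (at_point s) (Rbar_locally p_infty) L).
{ pose proof (is_RInt_gen_scal _ (/ q ^ 3) _
    (is_RInt_gen_laplace_K2 a (th + PI / 2) q s Ha)) as H.
  replace L with (scal (/ q ^ 3) (a ^ 2 * laplace a (th + PI / 2) q s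
      - exp (- (a * s)) * (kernel 1 (th + PI / 2) q s + a * kernel 0 (th + PI / 2) q s)))
    by exact (Rmult_comm _ _).
  apply is_RInt_gen_ext with (2 := H).
  apply filter_forall; intros ab w _.
  change (/ q ^ 3 * (exp (- (a * w)) * kernel 2 (th + PI / 2) q w)
    = exp (- (a * w)) * profile 2 (th + PI / 2) (q * w)); unfold kernel.
  field; lra. }
set (h := fun w => exp (- (a * w)) *
  (kernel 0 th r w - kernel 0 th q w - (r - q) * profile 2 (th + PI / 2) (q * w))).
assert (Hh : is_RInt_gen h (at_point s) (Rbar_locally p_infty)
  (laplace a th r s - laplace a th q s - (r - q) * L)).
{ pose proof (is_RInt_gen_minus _ _ _ _
    (is_RInt_gen_minus _ _ _ _ (is_RInt_gen_laplace a th r s Ha) (is_RInt_gen_laplace a th q s Ha))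
    (is_RInt_gen_scal _ (r - q) _ HL)) as H.
  apply is_RInt_gen_ext with (2 := H).
  apply filter_forall; intros ab w _; unfold h.
  match goal with |- minus (minus ?x ?y) (scal ?k ?z) = _ =>
    change (x - y - k * z = h w) end; unfold h; ring. }
assert (ch : forall w, continuous h w).
{ intros w; apply continuous_exp_mult.
  apply (continuous_minus (fun w => kernel 0 th r w - kernel 0 th q w)
    (fun w => (r - q) * profile 2 (th + PI / 2) (q * w))).
  - apply (continuous_minus (kernel 0 th r) (kernel 0 th q)); apply continuous_kernel.
  - apply (continuous_scal_r (r - q) (fun w => profile 2 (th + PI / 2) (q * w))).
    apply (continuous_comp (fun w => q * w) (profile 2 (th + PI / 2))).
    + apply (ex_derive_continuous (fun w => q * w)); auto_derive; auto.
    + apply continuous_profile. }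
apply integral_to_infty_eq in Hh; rewrite <- Hh.
replace (C / (a / 2) * exp (- (a / 2 * s)) * (r - q) ^ 2)
  with ((C * (r - q) ^ 2) / (a / 2) * exp (- (a / 2 * s))) by (field; lra).
apply (RInt_gen_dominated h s (a / 2) (C * (r - q) ^ 2) ch); [lra|].
intros w Hw.
assert (B : Rabs (kernel 0 th r w - kernel 0 th q w - (r - q) * profile 2 (th + PI / 2) (q * w))
   <= (Q ^ 3 + 3 * Q) * (1 + w ^ 4) * (r - q) ^ 2).
{ apply (taylor_remainder_order_2
    (fun q => kernel 0 th q w) (fun q => profile 2 (th + PI / 2) (q * w))
    (fun q => w * profile 3 (th + PI / 2) (q * w)) q r).
  - intros z; evar_last; [apply is_derive_kernel_q|simpl pow; ring].
  - intros z; apply (is_derive_comp (profile 2 (th + PI / 2)) (fun q => q * w));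
      [apply is_derive_profile|]. auto_derive; auto; ring.
  - intros z Hz.
    assert (Hz2 : Rabs z <= Q).
    { apply Rabs_lt_between in Hr; unfold Q; apply Rabs_le_between; revert Hz.
      unfold Rmin, Rmax; destruct Rle_dec; lra. }
    pose proof (Rabs_pos z) as Pz.
    rewrite Rabs_mult, (Rabs_pos_eq w) by lra.
    pose proof (profile_3_abs (th + PI / 2) (z * w)) as B3.
    rewrite Rabs_mult, (Rabs_pos_eq w) in B3 by lra.
    apply Rle_trans with (w * ((Rabs z * w) ^ 3 + 3 * (Rabs z * w))).
    { apply Rmult_le_compat_l; lra. }
    replace (w * ((Rabs z * w) ^ 3 + 3 * (Rabs z * w)))
      with (Rabs z ^ 3 * w ^ 4 + 3 * Rabs z * w ^ 2) by ring.
    pose proof (pow_incr (Rabs z) Q 3 (conj Pz Hz2)) as H3.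
    assert (W2 : w ^ 2 <= 1 + w ^ 4) by nra.
    assert (W4 : 0 <= w ^ 4) by (apply pow_le; lra).
    assert (W20 : 0 <= w ^ 2) by (apply pow_le; lra).
    pose proof (pow_le (Rabs z) 3 Pz) as P3.
    assert (T1 : Rabs z ^ 3 * w ^ 4 <= Q ^ 3 * (1 + w ^ 4))
      by (apply Rmult_le_compat; lra).
    assert (T2 : 3 * Rabs z * w ^ 2 <= 3 * Q * (1 + w ^ 4))
      by (apply Rmult_le_compat; lra).
    lra. }
unfold h; rewrite Rabs_mult, (Rabs_pos_eq (exp _)) by (left; apply exp_pos).
replace (- (a * w)) with (- (a / 2 * w) + - (a / 2 * w)) by field.
rewrite exp_plus, Rmult_assoc, (Rmult_comm _ (exp (- (a / 2 * w)))).
apply Rmult_le_compat_l; [left; apply exp_pos|].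
eapply Rle_trans; [apply Rmult_le_compat_l; [left; apply exp_pos|exact B]|].
pose proof (one_plus_pow4_le_exp (a / 2) w ltac:(lra) ltac:(lra)) as E.
rewrite exp_Ropp; pose proof (exp_pos (a / 2 * w)) as Pe.
apply (Rmult_le_reg_l (exp (a / 2 * w))); auto.
rewrite <- Rmult_assoc, Rinv_r, Rmult_1_l by lra.
apply Rle_trans with ((Q ^ 3 + 3 * Q) *
  ((1 + (4 / (a / 2)) ^ 4) * exp (a / 2 * w)) * (r - q) ^ 2); [|unfold C; right; ring].
apply Rmult_le_compat_r; [apply pow2_ge_0|].
apply Rmult_le_compat_l; auto.
assert (0 < Q) by (unfold Q; lra).
pose proof (pow_lt Q 3 H); lra.
Qed.

(** The [n]-th derivative in [s] of [G = exp (a s) * laplace a th q s], obtained by iterating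
    [G' = a G - K]. *)
Fixpoint memory (a : R) (n : nat) (th q s : R) : R :=
  match n with
  | O => exp (a * s) * laplace a th q s
  | S m => a * memory a m th q s - kernel m th q s
  end.

Lemma is_derive_memory_s (a : R) (n : nat) (th q s : R) : 0 < a ->
  is_derive (memory a n th q) s (memory a (S n) th q s).
Proof.
intros Ha; induction n as [|n IH].
- simpl; evar_last.
  + apply (is_derive_mult (fun s => exp (a * s)) (laplace a th q)).
    * auto_derive; auto.
    * now apply is_derive_laplace_s.
    * intros; apply Rmult_comm.
  + change (a * 1 * exp (a * s) * laplace a th q s
      + exp (a * s) * - (exp (- (a * s)) * kernel 0 th q s)
      = a * (exp (a * s) * laplace a th q s) - kernel 0 th q s).
    rewrite exp_Ropp; pose proof (exp_pos (a * s)); field; lra.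
- apply (is_derive_minus (fun s => a * memory a n th q s) (kernel n th q)).
  + apply (is_derive_scal (memory a n th q)), IH.
  + apply is_derive_kernel_z.
Qed.

Lemma continuous_memory (a : R) (n : nat) (th q s : R) : 0 < a ->
  continuous (memory a n th q) s.
Proof. intros; eapply is_derive_continuous; now apply is_derive_memory_s. Qed.

(** The boundary terms of [is_derive_laplace_q] are exactly those that turn [a^2 G] into
    the second space derivative of [G]; for larger [n] the rule is inherited through
    [G' = a G - K]. *)
Lemma is_derive_memory_t (a : R) (n : nat) (th t s : R) : 0 < a -> 0 < t -> 0 <= s ->
  is_derive (fun t => memory a n th (/ sqrt t) s) t
    (- (1 / 2) * memory a (S (S n)) (th + PI / 2) (/ sqrt t) s).
Proof.
intros Ha Ht Hs.
assert (Hq : 0 < / sqrt t) by (apply Rinv_0_lt_compat, sqrt_lt_R0; auto).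
induction n as [|n IH].
- evar_last.
  + apply (is_derive_scal (fun t => laplace a th (/ sqrt t) s)).
    apply (is_derive_comp (fun q => laplace a th q s) (fun t => / sqrt t)).
    * apply is_derive_laplace_q; auto.
    * apply is_derive_inv_sqrt; auto.
  + set (q := / sqrt t) in *; simpl memory.
    match goal with |- _ * scal ?x ?y = _ => change (scal x y) with (x * y) end.
    rewrite exp_Ropp; pose proof (exp_pos (a * s)); field; lra.
- evar_last.
  + apply (is_derive_minus (fun t => a * memory a n th (/ sqrt t) s)).
    * apply (is_derive_scal (fun t => memory a n th (/ sqrt t) s)), IH.
    * apply is_derive_kernel_t; auto.
  + unfold minus, plus, opp; simpl; ring.
Qed.

Lemma memory_add_PI (a : R) (n : nat) (th q s : R) : 0 < a ->
  memory a n (th + PI) q s = - memory a n th q s.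
Proof.
intros Ha; induction n as [|n IH]; simpl.
- enough (E : laplace a (th + PI) q s = - laplace a th q s) by (rewrite E; ring).
  apply integral_to_infty_eq.
  pose proof (is_RInt_gen_opp _ _ (is_RInt_gen_laplace a th q s Ha)) as H.
  apply is_RInt_gen_ext with (2 := H).
  apply filter_forall; intros ab w _.
  unfold kernel; rewrite profile_add_PI; unfold opp; simpl; ring.
- rewrite IH; unfold kernel; rewrite profile_add_PI; ring.
Qed.

(** The oscillation of the kernel makes its weighted integral small: one integration by
    parts against the Fresnel tail gains the factor [1 / (q s)]. *)
Lemma memory_decay (a th q s : R) : 0 < a -> 0 < q -> 0 < s ->
  Rabs (memory a 0 th q s) <= 4 / (q * s).
Proof.
intros Ha Hq Hs.
pose proof sqrt_2PI_ge_1 as Hr.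
set (c := sqrt (2 * PI) / 2 * cos (th - PI / 4)).
set (T := fun w => (fres th (q * w) - c) / sqrt (2 * PI)).
assert (HT : forall w, 0 < w -> Rabs (T w) <= 2 / (q * w)).
{ intros w Hw; unfold T, Rdiv at 1; rewrite Rabs_mult, (Rabs_pos_eq (/ _))
    by (left; apply Rinv_0_lt_compat; lra).
  assert (P : 0 < q * w) by (apply Rmult_lt_0_compat; auto).
  pose proof (fresnel th (q * w) P) as B; fold c in B.
  assert (I : / sqrt (2 * PI) <= 1)
    by (rewrite <- Rinv_1; apply Rinv_le_contravar; lra).
  rewrite <- (Rmult_1_r (2 / (q * w))); apply Rmult_le_compat; auto.
  - apply Rabs_pos.
  - left; apply Rinv_0_lt_compat; lra. }
assert (dT : forall w, is_derive T w (kernel 0 th q w)).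
{ intros w; unfold T, kernel; simpl profile; rewrite pow_1.
  apply (is_derive_ext (fun w => scal (/ sqrt (2 * PI)) (minus (fres th (q * w)) c))).
  { intros; unfold minus, plus, opp, scal; simpl; unfold mult; simpl; field; lra. }
  replace (q * (osc th (q * w) / sqrt (2 * PI)))
    with (scal (/ sqrt (2 * PI)) (minus (scal q (osc th (q * w))) 0)).
  2: { unfold minus, plus, opp, scal; simpl; unfold mult; simpl; field; lra. }
  apply (is_derive_scal (fun w => minus (fres th (q * w)) c)).
  apply (is_derive_minus (fun w => fres th (q * w)) (fun _ => c)).
  - apply (is_derive_comp (fres th) (fun w => q * w)); [apply is_derive_fres|].
    auto_derive; auto; ring.
  - apply (is_derive_const (V := R_NormedModule)). }
assert (cT : forall w, continuous T w) by (intros; eapply is_derive_continuous, dT).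
assert (Pqs : 0 < q * s) by (apply Rmult_lt_0_compat; auto).
set (F := fun w => exp (- (a * w)) * T w).
set (h := fun w => a * F w).
assert (Bh : forall w, s <= w -> Rabs (h w) <= a * (2 / (q * s)) * exp (- (a * w))).
{ intros w Hw; unfold h, F; rewrite !Rabs_mult, (Rabs_pos_eq a), (Rabs_pos_eq (exp _))
    by (try (left; apply exp_pos); lra).
  rewrite (Rmult_comm (exp _)), Rmult_assoc.
  apply Rmult_le_compat_l; [lra|]; apply Rmult_le_compat_r; [left; apply exp_pos|].
  eapply Rle_trans; [apply HT; lra|].
  unfold Rdiv; apply Rmult_le_compat_l; [lra|].
  apply Rinv_le_contravar; auto; apply Rmult_le_compat_l; lra. }
assert (cF : forall w, continuous F w) by (intros; apply continuous_exp_mult; auto).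
assert (ch : forall w, continuous h w)
  by (intros; apply (continuous_scal_r a F); auto).
set (f := fun w => exp (- (a * w)) * kernel 0 th q w - h w).
assert (HF : forall w, is_derive F w (f w)).
{ intros w; unfold F; evar_last.
  - apply (is_derive_mult (fun w => exp (- (a * w))) T).
    + auto_derive; auto.
    + apply dT.
    + intros; apply Rmult_comm.
  - unfold f, h, F, plus, mult; simpl; unfold mult; simpl. ring. }
assert (cf : forall w, continuous f w).
{ intros w; apply (continuous_minus (fun w => exp (- (a * w)) * kernel 0 th q w)); auto.
  apply continuous_exp_mult, continuous_kernel. }
assert (lim : filterlim F (Rbar_locally p_infty) (locally 0)).
{ apply (filterlim_infty_0 F (2 / q) 0); intros w Hw.
  unfold F; rewrite Rabs_mult, (Rabs_pos_eq (exp _)) by (left; apply exp_pos).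
  replace (2 / q / w) with (1 * (2 / (q * w))) by (field; lra).
  apply Rmult_le_compat; auto.
  - left; apply exp_pos.
  - apply Rabs_pos.
  - rewrite <- exp_0; left; apply exp_increasing.
    assert (0 < a * w) by (apply Rmult_lt_0_compat; auto); lra. }
pose proof (is_RInt_gen_antiderivative F f s HF cf lim) as H1.
pose proof (RInt_gen_correct (V := R_CompleteNormedModule) h
  (ex_RInt_gen_dominated h s a _ ch Ha Bh)) as H2.
pose proof (RInt_gen_dominated h s a _ ch Ha Bh) as B.
set (I := RInt_gen h (at_point s) (Rbar_locally p_infty)) in *.
assert (E : laplace a th q s = - F s + I).
{ apply integral_to_infty_eq.
  apply is_RInt_gen_ext with (2 := is_RInt_gen_plus _ _ _ _ H1 H2).
  apply filter_forall; intros ab w _.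
  change (f w + h w = exp (- (a * w)) * kernel 0 th q w); unfold f; ring. }
simpl memory; rewrite E.
assert (BF : Rabs (F s) <= exp (- (a * s)) * (2 / (q * s))).
{ unfold F; rewrite Rabs_mult, (Rabs_pos_eq (exp _)) by (left; apply exp_pos).
  apply Rmult_le_compat_l; [left; apply exp_pos|auto]. }
replace (a * (2 / (q * s)) / a * exp (- (a * s)))
  with (exp (- (a * s)) * (2 / (q * s))) in B by (field; lra).
rewrite Rabs_mult, (Rabs_pos_eq (exp _)) by (left; apply exp_pos).
assert (B2 : Rabs (- F s + I) <= exp (- (a * s)) * (4 / (q * s))).
{ eapply Rle_trans; [apply Rabs_triang|]; rewrite Rabs_Ropp.
  replace (exp (- (a * s)) * (4 / (q * s))) with
    (exp (- (a * s)) * (2 / (q * s)) + exp (- (a * s)) * (2 / (q * s))) by (field; lra).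
  lra. }
apply (Rmult_le_compat_l (exp (a * s))) in B2; [|left; apply exp_pos].
rewrite <- Rmult_assoc, <- exp_plus, Rplus_opp_r, exp_0, Rmult_1_l in B2; exact B2.
Qed.

(** * The kernel as an approximate identity *)

(** The second derivative of [|x - p|] is twice the Dirac mass at [p]. *)
Lemma RInt_abs_center (psi psi1 psi2 : R -> R) (l p r : R) :
  l <= p <= r ->
  (forall x, is_derive psi x (psi1 x)) -> (forall x, is_derive psi1 x (psi2 x)) ->
  (forall x, continuous psi2 x) ->
  psi l = 0 -> psi r = 0 -> psi1 l = 0 -> psi1 r = 0 ->
  RInt (fun x => Rabs (x - p) * psi2 x) l r = 2 * psi p.
Proof.
intros Hp H1 H2 c2 El Er El1 Er1.
assert (cc : forall x, continuous (fun x : R => (x - p) * psi2 x) x).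
{ intros x; apply (continuous_mult (fun x => x - p) psi2); auto.
  apply (ex_derive_continuous (fun x : R => x - p)); auto_derive; auto. }
assert (ca : forall x, continuous (fun x : R => Rabs (x - p) * psi2 x) x).
{ intros x; apply (continuous_mult (fun x => Rabs (x - p)) psi2); auto.
  apply (continuous_comp (fun x => x - p) Rabs); [|apply continuous_Rabs].
  apply (ex_derive_continuous (fun x : R => x - p)); auto_derive; auto. }
assert (E : forall u v, RInt (fun x => (x - p) * psi2 x) u v
   = ((v - p) * psi1 v - psi v) - ((u - p) * psi1 u - psi u)).
{ intros u v.
  apply (RInt_of_derive (fun x => (x - p) * psi1 x - psi x)); auto.
  intros x _; evar_last.
  - apply (is_derive_minus (fun x => (x - p) * psi1 x) psi); [|apply H1].
    apply (is_derive_mult (fun x => x - p) psi1); [|apply H2|intros; apply Rmult_comm].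
    auto_derive; auto.
  - change (1 * psi1 x + (x - p) * psi2 x - psi1 x = (x - p) * psi2 x); ring. }
rewrite (RInt_Chasles_cont (fun x => Rabs (x - p) * psi2 x) l p r ca).
rewrite (RInt_ext (fun x => Rabs (x - p) * psi2 x) (fun x => -1 * ((x - p) * psi2 x)) l p).
2: { rewrite Rmin_left, Rmax_right by lra; intros x Hx.
     rewrite Rabs_left by lra; as_R; ring. }
rewrite (RInt_ext (fun x => Rabs (x - p) * psi2 x) (fun x => (x - p) * psi2 x) p r).
2: { rewrite Rmin_left, Rmax_right by lra; intros x Hx.
     rewrite Rabs_pos_eq by lra; reflexivity. }
rewrite (RInt_scal_cont (fun x => (x - p) * psi2 x) (-1) l p cc), !E, El, Er, El1, Er1; as_R; ring.
Qed.

(** A second primitive of [profile 0 th]; subtracting the sine removes the derivative of the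
    factor [fres th z]. *)
Definition fresnel_primitive (th z : R) : R :=
  (z * fres th z - sin (z ^ 2 / 2 - th)) / sqrt (2 * PI).

Lemma is_derive_fresnel_primitive (th z : R) :
  is_derive (fresnel_primitive th) z (fres th z / sqrt (2 * PI)).
Proof.
pose proof sqrt_2PI_ge_1.
apply (is_derive_ext (fun z => / sqrt (2 * PI) * (z * fres th z - sin (z ^ 2 / 2 - th)))).
{ intros; unfold fresnel_primitive; as_R; field; lra. }
evar_last.
- apply (is_derive_scal (fun z => z * fres th z - sin (z ^ 2 / 2 - th))).
  apply (is_derive_minus (fun z => z * fres th z) (fun z => sin (z ^ 2 / 2 - th))).
  + apply (is_derive_mult (fun z => z) (fres th)).
    * apply (is_derive_id z).
    * apply is_derive_fres.
    * intros; apply Rmult_comm.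
  + auto_derive; [auto|reflexivity].
- match goal with |- _ * minus (plus (mult ?a ?b) (mult ?c ?d)) ?e = _ =>
    change (minus (plus (mult a b) (mult c d)) e) with (1 * b + z * d - e) end.
  unfold osc.
  replace (z * (z * 1) * / 2 + - th) with (z ^ 2 / 2 - th) by (simpl; lra).
  field; lra.
Qed.

(** [fres th z] approaches its limit at rate [2/z], so multiplying by [z] leaves a bounded
    error. *)
Lemma fresnel_primitive_asymptotic (th z : R) :
  Rabs (fresnel_primitive th z - cos (th - PI / 4) / 2 * Rabs z) <= 3.
Proof.
pose proof sqrt_2PI_ge_1 as Hr.
assert (P : forall z, 0 <= z -> Rabs (fresnel_primitive th z - cos (th - PI / 4) / 2 * z) <= 3).
{ clear z; intros z Hz.
  set (c := sqrt (2 * PI) / 2 * cos (th - PI / 4)).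
  replace (fresnel_primitive th z - cos (th - PI / 4) / 2 * z) with
    ((z * (fres th z - c) - sin (z ^ 2 / 2 - th)) * / sqrt (2 * PI))
    by (unfold fresnel_primitive, c; field; lra).
  assert (B : Rabs (z * (fres th z - c)) <= 2).
  { destruct (Req_dec z 0) as [->|Hz0]; [rewrite Rmult_0_l, Rabs_R0; lra|].
    rewrite Rabs_mult, (Rabs_pos_eq z) by lra.
    pose proof (fresnel th z ltac:(lra)) as F; fold c in F.
    apply (Rmult_le_compat_l z) in F; [|lra].
    replace (z * (2 / z)) with 2 in F by (field; lra); auto. }
  rewrite Rabs_mult, (Rabs_pos_eq (/ _)) by (left; apply Rinv_0_lt_compat; lra).
  rewrite <- (Rmult_1_r 3); apply Rmult_le_compat.
  - apply Rabs_pos.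
  - left; apply Rinv_0_lt_compat; lra.
  - unfold Rminus at 1; eapply Rle_trans; [apply Rabs_triang|]; rewrite Rabs_Ropp.
    assert (Rabs (sin (z ^ 2 / 2 - th)) <= 1) by apply Rabs_le, SIN_bound; lra.
  - rewrite <- Rinv_1; apply Rinv_le_contravar; lra. }
destruct (Rle_lt_dec 0 z) as [H|H].
- rewrite (Rabs_pos_eq z) by auto; auto.
- rewrite (Rabs_left z) by auto.
  replace (fresnel_primitive th z) with (fresnel_primitive th (- z)); [apply P; lra|].
  unfold fresnel_primitive; rewrite fres_odd; replace ((- z) ^ 2) with (z ^ 2) by ring.
  f_equal; ring.
Qed.

(** The kernel does not decay away from [p], so absolute values are useless until two
    integrations by parts have replaced it by its second primitive. That is
    [cos (th - pi/4) |x - p| / 2] up to [3/q], and [RInt_abs_center] applies. *)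
Lemma kernel_approximate_identity (psi psi1 psi2 : R -> R) (th q l p r M : R) :
  0 < q -> l <= p <= r ->
  (forall x, is_derive psi x (psi1 x)) -> (forall x, is_derive psi1 x (psi2 x)) ->
  (forall x, continuous psi2 x) ->
  (forall x, l <= x <= r -> Rabs (psi2 x) <= M) ->
  psi l = 0 -> psi r = 0 -> psi1 l = 0 -> psi1 r = 0 ->
  Rabs (RInt (fun x => kernel 0 th q (x - p) * psi x) l r - cos (th - PI / 4) * psi p)
    <= (r - l) * (3 / q * M).
Proof.
intros Hq Hp H1 H2 c2 HM El Er El1 Er1.
pose proof sqrt_2PI_ge_1 as Hr.
set (W := fun x => fresnel_primitive th (q * (x - p)) / q).
set (W1 := fun x => fres th (q * (x - p)) / sqrt (2 * PI)).
assert (lin : forall x, is_derive (fun x => q * (x - p)) x q)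
  by (intros; auto_derive; auto; ring).
assert (dW1 : forall x, is_derive W1 x (kernel 0 th q (x - p))).
{ intros x; unfold W1, kernel; rewrite pow_1; simpl profile.
  apply (is_derive_ext (fun x => / sqrt (2 * PI) * fres th (q * (x - p)))).
  { intros; as_R; field; lra. }
  replace (q * (osc th (q * (x - p)) / sqrt (2 * PI)))
    with (/ sqrt (2 * PI) * (q * osc th (q * (x - p)))) by (field; lra).
  apply (is_derive_scal (fun x => fres th (q * (x - p)))).
  apply (is_derive_comp (fres th) (fun x => q * (x - p))); auto; apply is_derive_fres. }
assert (dW : forall x, is_derive W x (W1 x)).
{ intros x; unfold W, W1.
  apply (is_derive_ext (fun x => / q * fresnel_primitive th (q * (x - p)))).
  { intros; as_R; field; lra. }
  replace (fres th (q * (x - p)) / sqrt (2 * PI))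
    with (/ q * (q * (fres th (q * (x - p)) / sqrt (2 * PI)))) by (field; lra).
  apply (is_derive_scal (fun x => fresnel_primitive th (q * (x - p)))).
  apply (is_derive_comp (fresnel_primitive th) (fun x => q * (x - p))); auto; apply is_derive_fresnel_primitive. }
assert (cK : forall x, continuous (fun x : R => kernel 0 th q (x - p)) x).
{ intros x; apply (continuous_comp (fun x => x - p) (kernel 0 th q)); [|apply continuous_kernel].
  apply (ex_derive_continuous (fun x : R => x - p)); auto_derive; auto. }
assert (c1 : forall x, continuous psi1 x) by (intros; eapply is_derive_continuous; auto).
assert (cW1 : forall x, continuous W1 x) by (intros; eapply is_derive_continuous; auto).
assert (cW : forall x, continuous W x) by (intros; eapply is_derive_continuous; auto).
rewrite (RInt_parts W1 _ psi psi1 l r dW1 H1 cK c1), (RInt_parts W W1 psi1 psi2 l r dW H2 cW1 c2).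
rewrite El, Er, El1, Er1, !Rmult_0_r.
set (c := cos (th - PI / 4)).
replace (c * psi p) with (c / 2 * (2 * psi p)) by field.
rewrite <- (RInt_abs_center psi psi1 psi2 l p r) by auto.
assert (ca : forall x, continuous (fun x : R => Rabs (x - p) * psi2 x) x).
{ intros x; apply (continuous_mult (fun x => Rabs (x - p)) psi2); auto.
  apply (continuous_comp (fun x => x - p) Rabs); [|apply continuous_Rabs].
  apply (ex_derive_continuous (fun x : R => x - p)); auto_derive; auto. }
assert (cWp : forall x, continuous (fun x : R => W x * psi2 x) x)
  by (intros; apply (continuous_mult W psi2); auto).
assert (cs : forall x, continuous (fun x : R => - (c / 2) * (Rabs (x - p) * psi2 x)) x)
  by (intros; apply (continuous_scal_r (- (c / 2)) (fun x => Rabs (x - p) * psi2 x)); auto).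
replace (0 - 0 - (0 - 0 - RInt (fun x => W x * psi2 x) l r)
    - c / 2 * RInt (fun x => Rabs (x - p) * psi2 x) l r)
  with (RInt (fun x => W x * psi2 x + - (c / 2) * (Rabs (x - p) * psi2 x)) l r).
2: { rewrite RInt_plus_cont, RInt_scal_cont by auto; as_R; ring. }
apply abs_RInt_le_const; [lra| |].
{ apply ex_RInt_cont; intros x.
  apply (continuous_plus (fun x => W x * psi2 x)); auto. }
intros x Hx.
replace (W x * psi2 x + - (c / 2) * (Rabs (x - p) * psi2 x))
  with ((W x - c / 2 * Rabs (x - p)) * psi2 x) by ring.
rewrite Rabs_mult; apply Rmult_le_compat; try apply Rabs_pos; auto.
unfold W.
replace (fresnel_primitive th (q * (x - p)) / q - c / 2 * Rabs (x - p))
  with ((fresnel_primitive th (q * (x - p)) - c / 2 * Rabs (q * (x - p))) * / q).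
2: { rewrite Rabs_mult, (Rabs_pos_eq q) by lra; field; lra. }
rewrite Rabs_mult, (Rabs_pos_eq (/ q)) by (left; apply Rinv_0_lt_compat; lra).
apply Rmult_le_compat_r; [left; apply Rinv_0_lt_compat; lra|apply fresnel_primitive_asymptotic].
Qed.

(** * The elastic solution as one of a family closed under differentiation *)

(** [wave a y 0 (PI / 4)] is the solution; the index counts space derivatives, and the phase
    records the number of time derivatives. *)
Definition wave (a y : R) (n : nat) (th t x : R) : R :=
  kernel n th (/ sqrt t) (x - y) + kernel n th (/ sqrt t) (x + y)
  - 2 * a * memory a n th (/ sqrt t) (x + y).

Lemma is_derive_wave_x (a y : R) (n : nat) (th t x : R) : 0 < a ->
  is_derive (wave a y n th t) x (wave a y (S n) th t x).
Proof.
intros Ha; unfold wave; set (q := / sqrt t).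
assert (tr : forall (f : R -> R) (d f' : R), is_derive f (x + d) f' ->
  is_derive (fun x => f (x + d)) x f').
{ intros f d f' H; evar_last.
  - apply (is_derive_comp f (fun x => x + d)); [exact H|auto_derive; auto].
  - apply Rmult_1_l. }
apply (is_derive_minus (fun x => kernel n th q (x - y) + kernel n th q (x + y))).
- apply (is_derive_plus (fun x => kernel n th q (x - y))).
  + apply (tr (kernel n th q) (- y)), is_derive_kernel_z.
  + apply (tr (kernel n th q) y), is_derive_kernel_z.
- apply (is_derive_scal (fun x => memory a n th q (x + y))).
  apply (tr (memory a n th q) y); now apply is_derive_memory_s.
Qed.

Lemma continuous_wave (a y : R) (n : nat) (th t x : R) : 0 < a ->
  continuous (wave a y n th t) x.
Proof. intros; eapply is_derive_continuous; now apply is_derive_wave_x. Qed.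

Lemma is_derive_wave_t (a y : R) (n : nat) (th t x : R) : 0 < a -> 0 < t -> 0 <= x + y ->
  is_derive (fun t => wave a y n th t x) t
    (- (1 / 2) * wave a y (S (S n)) (th + PI / 2) t x).
Proof.
intros Ha Ht Hs; unfold wave; evar_last.
- apply (is_derive_minus (fun t => kernel n th (/ sqrt t) (x - y) + kernel n th (/ sqrt t) (x + y))).
  + apply (is_derive_plus (fun t => kernel n th (/ sqrt t) (x - y))); now apply is_derive_kernel_t.
  + apply (is_derive_scal (fun t => memory a n th (/ sqrt t) (x + y))).
    now apply is_derive_memory_t.
- match goal with |- minus (plus ?a ?b) ?c = _ =>
    change (minus (plus a b) c) with (a + b - c) end; ring.
Qed.

Lemma wave_add_PI (a y : R) (n : nat) (th t x : R) : 0 < a ->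
  wave a y n (th + PI) t x = - wave a y n th t x.
Proof.
intros Ha; unfold wave; rewrite memory_add_PI by auto; unfold kernel; rewrite !profile_add_PI; ring.
Qed.

(** A sequence of functions, each the derivative of the previous one on an open set,
    computes the iterated total derivatives there. *)
Lemma Derive_n_chain (F : nat -> R -> R) (f : R -> R) (D : R -> Prop) :
  (forall x, D x -> locally x D) -> (forall x, D x -> f x = F O x) ->
  (forall n x, D x -> is_derive (F n) x (F (S n) x)) ->
  forall n x, D x -> ex_derive_n f n x /\ Derive_n f n x = F n x.
Proof.
intros HD H0 HF n; induction n as [|n IH]; intros x Hx; [split; simpl; auto|].
assert (H : is_derive (Derive_n f n) x (F (S n) x)).
{ apply (is_derive_ext_loc (F n)); [|auto].
  apply filter_imp with (2 := HD x Hx); intros z Hz; symmetry; now apply IH. }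
split; [now exists (F (S n) x)|now apply is_derive_unique].
Qed.

Lemma wave_pde (a y : R) (u : R -> R -> R) (th : R) : 0 < a -> 0 < y ->
  (forall x t, 0 < t -> u x t = wave a y 0 th t x) -> pde u.
Proof.
intros Ha Hy Hu x t Hx Ht.
assert (T : forall n s, 0 < s ->
  ex_derive_n (fun s => u x s) n s /\
  Derive_n (fun s => u x s) n s
    = (- (1 / 2)) ^ n * wave a y (2 * n) (th + INR n * (PI / 2)) s x).
{ apply (Derive_n_chain
    (fun n s => (- (1 / 2)) ^ n * wave a y (2 * n) (th + INR n * (PI / 2)) s x)
    _ (fun s => 0 < s)).
  - intros s Hs; now apply (open_gt 0).
  - intros s Hs; simpl; rewrite Hu by auto; rewrite Rmult_0_l, Rplus_0_r; ring.
  - intros n s Hs; evar_last.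
    + apply (is_derive_scal (fun s => wave a y (2 * n) (th + INR n * (PI / 2)) s x)).
      apply is_derive_wave_t; auto; lra.
    + replace (2 * S n)%nat with (S (S (2 * n))) by lia.
      replace (th + INR (S n) * (PI / 2)) with (th + INR n * (PI / 2) + PI / 2)
        by (rewrite S_INR; ring).
      simpl pow; ring. }
assert (X : forall n z, True ->
  ex_derive_n (fun z => u z t) n z /\ Derive_n (fun z => u z t) n z = wave a y n th t z).
{ apply (Derive_n_chain (fun n z => wave a y n th t z)).
  - intros; apply filter_forall; auto.
  - intros; auto.
  - intros n z _; now apply is_derive_wave_x. }
split; [intros k _; now apply T|]; split; [intros k _; now apply X|].
unfold dtt, dxxxx.
rewrite (proj2 (T 2%nat t Ht)), (proj2 (X 4%nat x I)).
replace (th + INR 2 * (PI / 2)) with (th + PI) by (simpl; field).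
rewrite wave_add_PI by auto; simpl (2 * 2)%nat; field.
Qed.

(** The terms in [G] cancel because [G' - a G = - K]; what remains is zero because [K] is
    even and its derivative odd. *)
Lemma wave_boundary (a y th t : R) : wave a y 1 th t 0 = a * wave a y 0 th t 0.
Proof.
unfold wave; simpl memory; rewrite Rplus_0_l, Rminus_0_l; unfold kernel.
replace (/ sqrt t * - y) with (- (/ sqrt t * y)) by ring.
rewrite !profile_even; ring.
Qed.

Lemma wave_elastic_bc (a y : R) (u : R -> R -> R) (th : R) : 0 < a ->
  (forall x t, 0 < t -> u x t = wave a y 0 th t x) -> elastic_bc a u.
Proof.
intros Ha Hu t Ht.
assert (D : forall x, is_derive (fun x => u x t) x (wave a y 1 th t x)).
{ intros x; apply (is_derive_ext (wave a y 0 th t)); [intros; symmetry; auto|].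
  now apply is_derive_wave_x. }
split.
- exists (wave a y 1 th t 0); split.
  + pose proof (proj1 (is_derive_Reals _ _ _) (D 0)) as D0.
    apply filterlim_locally; intros eps.
    destruct (D0 eps (cond_pos eps)) as [d Hd].
    exists d; intros h Hh Hpos.
    change (Rabs (h - 0) < d) in Hh; rewrite Rminus_0_r in Hh.
    specialize (Hd h ltac:(lra) Hh); rewrite Rplus_0_l in Hd; exact Hd.
  + rewrite Hu, wave_boundary by auto; ring.
- apply filterlim_ext with (fun x => wave a y 1 th t x - a * wave a y 0 th t x).
  { intros x; unfold dx; rewrite Hu by auto; f_equal.
    symmetry; apply is_derive_unique, D. }
  eapply filterlim_filter_le_1; [apply filter_le_within|].
  replace 0 with (wave a y 1 th t 0 - a * wave a y 0 th t 0) at 2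
    by (rewrite wave_boundary; ring).
  apply (continuous_minus (wave a y 1 th t) (fun x => a * wave a y 0 th t x)).
  + now apply continuous_wave.
  + apply (continuous_scal_r a (wave a y 0 th t)); now apply continuous_wave.
Qed.

(** * Initial values *)

Lemma RInt_support (g : R -> R) (a b l r : R) :
  (forall x, continuous g x) -> (forall x, x < a \/ b < x -> g x = 0) ->
  l <= a -> a <= b -> b <= r -> RInt g l r = RInt g a b.
Proof.
intros cg H la ab br.
assert (Z : forall u v, u <= v -> (forall x, u < x < v -> x < a \/ b < x) ->
  RInt g u v = 0).
{ intros u v uv Huv; rewrite (RInt_ext g (fun _ => 0)).
  - rewrite RInt_const; apply Rmult_0_r.
  - rewrite Rmin_left, Rmax_right by auto; intros x Hx; auto. }
rewrite (RInt_Chasles_cont g l a r cg), (RInt_Chasles_cont g a b r cg).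
rewrite (Z l a), (Z b r) by (auto; intros; lra).
as_R; ring.
Qed.

(** For a function supported away from [0], both improper endpoints are eventually outside
    the support. *)
Lemma is_RInt_gen_support (g : R -> R) (a b : R) :
  (forall x, continuous g x) -> (forall x, x < a \/ b < x -> g x = 0) ->
  0 < a -> a <= b ->
  is_RInt_gen g (at_right 0) (Rbar_locally p_infty) (RInt g a b).
Proof.
intros cg H Ha Hab.
apply (filterlimi_locally (F := filter_prod (at_right 0) (Rbar_locally p_infty))).
intros eps.
exists (fun l => l < a) (fun r => b < r).
- exists (mkposreal a Ha); intros l Hl _.
  change (Rabs (l - 0) < a) in Hl; apply Rabs_lt_between in Hl; lra.
- now exists b.
- intros l r Hl Hr; exists (RInt g l r); split.
  + apply (@RInt_correct R_CompleteNormedModule), ex_RInt_cont; auto.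
  + rewrite (RInt_support g a b l r) by (auto; lra); apply ball_center.
Qed.

Lemma is_derive_test (phi : R -> R) (n : nat) (x : R) :
  (forall n x, ex_derive_n phi n x) ->
  is_derive (Derive_n phi n) x (Derive_n phi (S n) x).
Proof. intros H; apply (Derive_correct (Derive_n phi n)), (H (S n)). Qed.

Lemma continuous_test (phi : R -> R) (n : nat) (x : R) :
  (forall n x, ex_derive_n phi n x) -> continuous (Derive_n phi n) x.
Proof. intros H; eapply is_derive_continuous, is_derive_test, H. Qed.

Lemma Derive_n_support (phi : R -> R) (a b : R) (n : nat) (x : R) :
  (forall x, x < a \/ b < x -> phi x = 0) -> x < a \/ b < x -> Derive_n phi n x = 0.
Proof.
intros H Hx.
rewrite (Derive_n_ext_loc phi (fun _ => 0) n x).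
- destruct n; [reflexivity|apply Derive_n_const].
- destruct Hx as [Hx|Hx].
  + apply filter_imp with (2 := open_lt a x Hx); auto.
  + apply filter_imp with (2 := open_gt b x Hx); auto.
Qed.

Lemma continuous_bounded (f : R -> R) (a b : R) :
  (forall x, continuous f x) -> exists M, 0 <= M /\ forall x, a <= x <= b -> Rabs (f x) <= M.
Proof.
intros cf.
destruct (bounded_continuity (V := R_NormedModule) f a b) as [M HM].
{ intros x _; apply cf. }
exists (Rmax 0 M); split; [apply Rmax_l|].
intros x Hx; left; eapply Rlt_le_trans; [apply (HM x Hx)|apply Rmax_r].
Qed.

Lemma wave_weak_limit (a y th A B : R) (phi : R -> R) :
  0 < a -> 0 < y -> (forall n x, ex_derive_n phi n x) -> 0 < A -> A < B ->
  (forall x, x < A \/ B < x -> phi x = 0) ->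
  exists C, forall t, 0 < t ->
    Rabs (RInt (fun x => wave a y 0 th t x * phi x) A B - cos (th - PI / 4) * phi y)
      <= C * sqrt t.
Proof.
intros Ha Hy Hphi HA HAB Hsupp.
(* The interval must contain the support and both centres y and -y. *)
set (l := - y - 1); set (r := B + y + 1).
destruct (continuous_bounded (Derive_n phi 2) l r) as [M [PM HM]].
{ intros; now apply continuous_test. }
destruct (continuous_bounded phi A B) as [N [PN HN]].
{ intros x; apply (continuous_test phi 0 x Hphi). }
exists (2 * ((r - l) * (3 * M)) + (B - A) * (2 * a * (4 / y) * N)).
intros t Ht.
assert (Hst := sqrt_lt_R0 t Ht).
assert (Hq : 0 < / sqrt t) by (apply Rinv_0_lt_compat; auto).
unfold wave; set (q := / sqrt t) in *.
assert (cphi : forall x, continuous phi x)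
  by (intros x; apply (continuous_test phi 0 x Hphi)).
assert (cK : forall d x, continuous (fun x : R => kernel 0 th q (x - d) * phi x) x).
{ intros d x; apply (continuous_mult (fun x => kernel 0 th q (x - d)) phi); auto.
  apply (continuous_comp (fun x => x - d) (kernel 0 th q)); [|apply continuous_kernel].
  apply (ex_derive_continuous (fun x : R => x - d)); auto_derive; auto. }
assert (cG : forall x, continuous (fun x : R => -2 * a * memory a 0 th q (x + y) * phi x) x).
{ intros x; apply (continuous_mult (fun x => -2 * a * memory a 0 th q (x + y)) phi); auto.
  apply (continuous_scal_r (-2 * a) (fun x => memory a 0 th q (x + y))).
  apply (continuous_comp (fun x => x + y) (memory a 0 th q)); [|now apply continuous_memory].
  apply (ex_derive_continuous (fun x : R => x + y)); auto_derive; auto. }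
assert (near : forall p, l <= p <= r ->
  Rabs (RInt (fun x => kernel 0 th q (x - p) * phi x) A B - cos (th - PI / 4) * phi p)
    <= (r - l) * (3 / q * M)).
{ intros p Hp.
  rewrite <- (RInt_support _ A B l r (cK p)) by
    (try (intros x Hx; rewrite (Hsupp x Hx); ring); unfold l, r; lra).
  apply (kernel_approximate_identity phi (Derive_n phi 1) (Derive_n phi 2)); auto.
  - intros x; apply (is_derive_test phi 0 x Hphi).
  - intros x; apply (is_derive_test phi 1 x Hphi).
  - intros x; now apply continuous_test.
  - apply Hsupp; unfold l; lra.
  - apply Hsupp; unfold r; lra.
  - apply (Derive_n_support phi A B); auto; unfold l; lra.
  - apply (Derive_n_support phi A B); auto; unfold r; lra. }
pose proof (near y ltac:(unfold l, r; lra)) as N1.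
pose proof (near (- y) ltac:(unfold l, r; lra)) as N2.
rewrite (Hsupp (- y)), Rmult_0_r, Rminus_0_r in N2 by lra.
assert (N3 : Rabs (RInt (fun x => -2 * a * memory a 0 th q (x + y) * phi x) A B)
  <= (B - A) * (2 * a * (4 / (q * y)) * N)).
{ apply abs_RInt_le_const; [lra|now apply ex_RInt_cont|].
  intros x Hx; rewrite !Rabs_mult; apply Rmult_le_compat; auto.
  - repeat apply Rmult_le_pos; apply Rabs_pos.
  - apply Rabs_pos.
  - rewrite (Rabs_left (-2)), (Rabs_pos_eq a) by lra.
    replace (- -2) with 2 by ring.
    apply Rmult_le_compat_l; [lra|].
    eapply Rle_trans; [apply memory_decay; auto; lra|].
    unfold Rdiv; apply Rmult_le_compat_l; [lra|].
    apply Rinv_le_contravar; [now apply Rmult_lt_0_compat|].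
    apply Rmult_le_compat_l; lra. }
rewrite (RInt_ext _ (fun x => kernel 0 th q (x - y) * phi x
   + (kernel 0 th q (x - - y) * phi x + -2 * a * memory a 0 th q (x + y) * phi x))).
2: { intros x _; replace (x - - y) with (x + y) by ring; as_R; ring. }
rewrite RInt_plus_cont, RInt_plus_cont; auto.
2: { intros x; apply (continuous_plus (fun x => kernel 0 th q (x - - y) * phi x)); auto. }
set (I1 := RInt (fun x => kernel 0 th q (x - y) * phi x) A B) in *.
set (I2 := RInt (fun x => kernel 0 th q (x - - y) * phi x) A B) in *.
set (I3 := RInt (fun x => -2 * a * memory a 0 th q (x + y) * phi x) A B) in *.
set (c := cos (th - PI / 4) * phi y) in *.
change (I1 + (I2 + I3)) with (Rplus I1 (Rplus I2 I3)).
replace (I1 + (I2 + I3) - c) with ((I1 - c) + (I2 + I3)) by (as_R; ring).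
eapply Rle_trans; [apply Rabs_triang|].
eapply Rle_trans; [apply Rplus_le_compat_l, Rabs_triang|].
replace (3 / q) with (3 * sqrt t) in * by (unfold q; field; lra).
replace (4 / (q * y)) with (4 / y * sqrt t) in * by (unfold q; field; lra).
lra.
Qed.

Lemma filterlim_at_right_sqrt (f : R -> R) (l C : R) :
  (forall t, 0 < t -> Rabs (f t - l) <= C * sqrt t) ->
  filterlim f (at_right 0) (locally l).
Proof.
intros H; apply filterlim_locally; intros eps.
pose proof (cond_pos eps) as He.
set (k := eps / (Rabs C + 1)).
assert (HC : 0 < Rabs C + 1) by (pose proof (Rabs_pos C); lra).
assert (Hk : 0 < k) by (apply Rdiv_lt_0_compat; auto).
assert (Hk2 : 0 < k ^ 2) by (apply pow_lt; auto).
exists (mkposreal _ Hk2); intros t Ht Hpos.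
change (Rabs (t - 0) < k ^ 2) in Ht; rewrite Rminus_0_r, Rabs_pos_eq in Ht by lra.
change (Rabs (f t - l) < eps).
eapply Rle_lt_trans; [now apply H|].
assert (Hs : sqrt t < k).
{ rewrite <- (sqrt_pow2 k) by lra; apply sqrt_lt_1; lra. }
pose proof (sqrt_pos t) as Ps; pose proof (Rle_abs C) as PC.
apply Rle_lt_trans with ((Rabs C + 1) * sqrt t).
- apply Rmult_le_compat_r; lra.
- apply (Rmult_lt_compat_l (Rabs C + 1)) in Hs; auto.
  unfold k in Hs; replace ((Rabs C + 1) * (eps / (Rabs C + 1))) with (pos eps) in Hs
    by (field; lra); auto.
Qed.

(** [v] needs to agree with the regular representative [V] only for [x > 0], since test
    functions vanish elsewhere. *)
Lemma distr_initial_value_intro (v V : R -> R -> R) (T : (R -> R) -> R) :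
  (forall x t, 0 < x -> 0 < t -> v x t = V t x) ->
  (forall t x, 0 < t -> continuous (V t) x) ->
  (forall phi A B, (forall n x, ex_derive_n phi n x) -> 0 < A -> A < B ->
    (forall x, x < A \/ B < x -> phi x = 0) ->
    exists C, forall t, 0 < t ->
      Rabs (RInt (fun x => V t x * phi x) A B - T phi) <= C * sqrt t) ->
  distr_initial_value v T.
Proof.
intros Hv cV H phi [Hphi [A [B [HA [HAB Hsupp]]]]].
assert (E : forall t, 0 < t ->
  is_RInt_gen (fun x => v x t * phi x) (at_right 0) (Rbar_locally p_infty)
    (RInt (fun x => V t x * phi x) A B)).
{ intros t Ht.
  apply is_RInt_gen_ext with (fun x => V t x * phi x).
  - apply filter_forall; intros ab x _.
    destruct (Rlt_le_dec 0 x) as [Hx|Hx]; [now rewrite Hv|].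
    rewrite Hsupp by lra; as_R; ring.
  - apply is_RInt_gen_support; auto; try lra.
    + intros x; apply (continuous_mult (V t) phi); auto.
      apply (continuous_test phi 0 x Hphi).
    + intros x Hx; rewrite Hsupp by auto; ring. }
split.
- intros t Ht; eexists; now apply E.
- destruct (H phi A B Hphi HA HAB Hsupp) as [C HC].
  apply (filterlim_at_right_sqrt _ _ C); intros t Ht.
  rewrite (is_RInt_gen_unique (V := R_CompleteNormedModule) _ _ (E t Ht)); auto.
Qed.

Lemma wave_initial_value (a y : R) (u : R -> R -> R) : 0 < a -> 0 < y ->
  (forall x t, 0 < t -> u x t = wave a y 0 (PI / 4) t x) ->
  distr_initial_value u (dirac y).
Proof.
intros Ha Hy Hu.
apply (distr_initial_value_intro _ (wave a y 0 (PI / 4))).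
- intros; auto.
- intros; now apply continuous_wave.
- intros phi A B Hphi HA HAB Hsupp.
  destruct (wave_weak_limit a y (PI / 4) A B phi Ha Hy Hphi HA HAB Hsupp) as [C HC].
  exists C; intros t Ht; specialize (HC t Ht).
  rewrite Rminus_diag, cos_0, Rmult_1_l in HC; exact HC.
Qed.

(** The velocity is a second space derivative, which passes to the test function; the phase
    [3 pi/4] makes the limiting coefficient vanish. *)
Lemma wave_initial_velocity (a y : R) (u : R -> R -> R) : 0 < a -> 0 < y ->
  (forall x t, 0 < t -> u x t = wave a y 0 (PI / 4) t x) ->
  distr_initial_value (dt u) zero_distr.
Proof.
intros Ha Hy Hu.
set (th := PI / 4 + PI / 2).
apply (distr_initial_value_intro _ (fun t x => - (1 / 2) * wave a y 2 th t x)).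
- intros x t Hx Ht; unfold dt; apply is_derive_unique.
  apply (is_derive_ext_loc (fun t => wave a y 0 (PI / 4) t x)).
  + apply filter_imp with (2 := open_gt 0 t Ht); intros; symmetry; auto.
  + apply is_derive_wave_t; auto; lra.
- intros t x _; apply (continuous_scal_r (- (1 / 2)) (wave a y 2 th t)); now apply continuous_wave.
- intros phi A B Hphi HA HAB Hsupp.
  assert (Hphi2 : forall n x, ex_derive_n (Derive_n phi 2) n x).
  { intros [|n] x; [exact I|].
    change (ex_derive (Derive_n (Derive_n phi 2) n) x).
    apply (ex_derive_ext (Derive_n phi (n + 2))).
    - intros z; symmetry; apply Derive_n_comp.
    - apply (Hphi (S (n + 2))). }
  assert (Hsupp2 : forall n x, x < A \/ B < x -> Derive_n phi n x = 0)
    by (intros; now apply (Derive_n_support phi A B)).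
  destruct (wave_weak_limit a y th A B (Derive_n phi 2) Ha Hy Hphi2 HA HAB (Hsupp2 2%nat))
    as [C HC].
  exists C; intros t Ht; specialize (HC t Ht).
  replace (th - PI / 4) with (PI / 2) in HC by (unfold th; ring).
  rewrite cos_PI2, Rmult_0_l, Rminus_0_r in HC.
  unfold zero_distr; rewrite Rminus_0_r.
  assert (cc : forall m n x, continuous (fun x : R => wave a y m th t x * Derive_n phi n x) x).
  { intros m n x; apply (continuous_mult (wave a y m th t)).
    - now apply continuous_wave.
    - now apply continuous_test. }
  (* The endpoints A - 1 and B + 1 are outside the support, so no boundary terms arise. *)
  assert (parts : forall m n,
    RInt (fun x => wave a y (S m) th t x * Derive_n phi n x) (A - 1) (B + 1)
    = - RInt (fun x => wave a y m th t x * Derive_n phi (S n) x) (A - 1) (B + 1)).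
  { intros m n.
    rewrite (RInt_parts (wave a y m th t) (wave a y (S m) th t)
      (Derive_n phi n) (Derive_n phi (S n))).
    - rewrite !(Hsupp2 n) by lra; as_R; ring.
    - intros; now apply is_derive_wave_x.
    - intros; now apply is_derive_test.
    - intros; now apply continuous_wave.
    - intros; now apply continuous_test. }
  assert (E : RInt (fun x => wave a y 2 th t x * phi x) A B
    = RInt (fun x => wave a y 0 th t x * Derive_n phi 2 x) A B).
  { rewrite <- (RInt_support (fun x => wave a y 2 th t x * phi x) A B (A - 1) (B + 1));
      try lra; [|apply (cc 2%nat 0%nat)|intros x Hx; rewrite Hsupp by auto; ring].
    rewrite <- (RInt_support (fun x => wave a y 0 th t x * Derive_n phi 2 x) A B (A - 1) (B + 1));
      try lra; [|apply cc|intros x Hx; rewrite Hsupp2 by auto; ring].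
    change (fun x => wave a y 2 th t x * phi x)
      with (fun x => wave a y 2 th t x * Derive_n phi 0 x).
    rewrite (parts 1%nat 0%nat), (parts 0%nat 1%nat); as_R; ring. }
  rewrite (RInt_ext _ (fun x => - (1 / 2) * (wave a y 2 th t x * phi x)))
    by (intros; as_R; ring).
  rewrite RInt_scal_cont by apply (cc 2%nat 0%nat).
  rewrite E, Rabs_mult, Rabs_Ropp, (Rabs_pos_eq (1 / 2)) by lra.
  pose proof (Rabs_pos (RInt (fun x => wave a y 0 th t x * Derive_n phi 2 x) A B)); lra.
Qed.

(** * The two displayed formulas *)

Lemma kernel_formula (th t z : R) : 0 < t ->
  1 / sqrt (2 * PI * t) * cos (z ^ 2 / (2 * t) - th) = kernel 0 th (/ sqrt t) z.
Proof.
intros Ht; assert (Hs := sqrt_lt_R0 t Ht); pose proof sqrt_2PI_ge_1 as Hr.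
unfold kernel; simpl profile; unfold osc; rewrite pow_1.
rewrite sqrt_mult by (pose proof PI_RGT_0; lra).
replace ((/ sqrt t * z) ^ 2 / 2) with (z ^ 2 / (2 * t)).
- field; lra.
- rewrite <- (sqrt_sqrt t) at 1 by lra; field; lra.
Qed.

Lemma integrand2_kernel (a t w : R) : 0 < t ->
  integrand2 a t w = sqrt (2 * PI * t) * (exp (- (a * w)) * kernel 0 (PI / 4) (/ sqrt t) w).
Proof.
intros Ht; rewrite <- kernel_formula by auto; unfold integrand2.
assert (0 < sqrt (2 * PI * t))
  by (apply sqrt_lt_R0, Rmult_lt_0_compat; pose proof PI_RGT_0; lra).
field; lra.
Qed.

Lemma integrand1_kernel (a t w : R) : 0 < t ->
  integrand1 a t w = -1 * (exp (- (a * w)) * kernel 1 (PI / 4) (/ sqrt t) w).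
Proof.
intros Ht; assert (Hs := sqrt_lt_R0 t Ht); pose proof sqrt_2PI_ge_1 as Hr.
unfold integrand1, kernel; simpl profile; unfold osc.
assert (E : sqrt (2 * PI * t ^ 3) = sqrt (2 * PI) * sqrt t ^ 3).
{ rewrite sqrt_mult by (try apply pow_le; pose proof PI_RGT_0; lra).
  f_equal. replace (t ^ 3) with (t * (t * t)) by ring.
  rewrite sqrt_mult, sqrt_square by nra.
  rewrite <- (sqrt_sqrt t) at 2 by lra; ring. }
rewrite E.
replace ((/ sqrt t * w) ^ 2 / 2 - (PI / 4 - PI / 2))
  with (w ^ 2 / (2 * t) - 3 * PI / 4 + PI).
2: { rewrite <- (sqrt_sqrt t) at 1 by lra; field; lra. }
rewrite neg_cos; field; lra.
Qed.

Lemma is_RInt_gen_integrand2 (a t s : R) : 0 < a -> 0 < t ->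
  is_RInt_gen (integrand2 a t) (at_point s) (Rbar_locally p_infty)
    (sqrt (2 * PI * t) * laplace a (PI / 4) (/ sqrt t) s).
Proof.
intros Ha Ht.
apply is_RInt_gen_ext with (2 := is_RInt_gen_scal _ (sqrt (2 * PI * t)) _
  (is_RInt_gen_laplace a (PI / 4) (/ sqrt t) s Ha)).
apply filter_forall; intros ab w _; now rewrite integrand2_kernel.
Qed.

(** Here [integrand1] is [- exp (-a w) K'(w)], so integrating by parts expresses it
    through [laplace]. This is the equality of the two displayed formulas. *)
Lemma is_RInt_gen_integrand1 (a t s : R) : 0 < a -> 0 < t ->
  is_RInt_gen (integrand1 a t) (at_point s) (Rbar_locally p_infty)
    (exp (- (a * s)) * kernel 0 (PI / 4) (/ sqrt t) s - a * laplace a (PI / 4) (/ sqrt t) s).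
Proof.
intros Ha Ht; set (th := PI / 4); set (q := / sqrt t).
set (F := fun w => - (exp (- (a * w)) * kernel 0 th q w)).
set (f := fun w => exp (- (a * w)) * (a * kernel 0 th q w - kernel 1 th q w)).
assert (HF : forall w, is_derive F w (f w)).
{ intros w; unfold F; evar_last.
  - apply (is_derive_opp (fun w => exp (- (a * w)) * kernel 0 th q w)).
    apply (is_derive_mult (fun w => exp (- (a * w))) (kernel 0 th q)).
    + auto_derive; auto.
    + apply is_derive_kernel_z.
    + intros; apply Rmult_comm.
  - match goal with |- opp (plus (mult ?a ?b) (mult ?c ?d)) = _ =>
      change (- (a * b + c * d) = f w) end; unfold f; ring. }
assert (cf : forall w, continuous f w).
{ intros w; apply continuous_exp_mult.
  apply (continuous_minus (fun w => a * kernel 0 th q w) (kernel 1 th q)).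
  - apply (continuous_scal_r a (kernel 0 th q)), continuous_kernel.
  - apply continuous_kernel. }
assert (lim : filterlim F (Rbar_locally p_infty) (locally 0)).
{ apply (filterlim_infty_0 F (Rabs q / a) 0); intros w Hw.
  unfold F; rewrite Rabs_Ropp.
  eapply Rle_trans; [apply exp_kernel_dominated|].
  replace (Rabs q / a / w) with (Rabs q * / (a * w)) by (field; lra).
  apply Rmult_le_compat_l; [apply Rabs_pos|]; rewrite exp_Ropp.
  assert (0 < a * w) by (apply Rmult_lt_0_compat; auto).
  apply Rinv_le_contravar; auto. pose proof (exp_ineq1 (a * w)); lra. }
pose proof (is_RInt_gen_antiderivative F f s HF cf lim) as H1.
pose proof (is_RInt_gen_scal _ a _ (is_RInt_gen_laplace a th q s Ha)) as H2.
pose proof (is_RInt_gen_minus _ _ _ _ H1 H2) as H.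
replace (exp (- (a * s)) * kernel 0 th q s - a * laplace a th q s)
  with (minus (- F s) (scal a (laplace a th q s))).
2: { change (- F s - a * laplace a th q s = exp (- (a * s)) * kernel 0 th q s - a * laplace a th q s).
     unfold F; ring. }
apply is_RInt_gen_ext with (2 := H).
apply filter_forall; intros ab w _; rewrite integrand1_kernel by auto; fold th q.
change (f w - a * (exp (- (a * w)) * kernel 0 th q w)
  = -1 * (exp (- (a * w)) * kernel 1 th q w)); unfold f; ring.
Qed.

Lemma u_el_wave (a y x t : R) : 0 < a -> 0 < t ->
  u_el a y x t = wave a y 0 (PI / 4) t x.
Proof.
intros Ha Ht; unfold u_el, wave.
rewrite (integral_to_infty_eq _ _ _ (is_RInt_gen_integrand1 a t (x + y) Ha Ht)).
rewrite Rmult_minus_distr_l, !kernel_formula by auto; simpl memory.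
rewrite exp_Ropp; pose proof (exp_pos (a * (x + y))); field; lra.
Qed.

Lemma u_el_alt_wave (a y x t : R) : 0 < a -> 0 < t ->
  u_el_alt a y x t = wave a y 0 (PI / 4) t x.
Proof.
intros Ha Ht; unfold u_el_alt, wave.
rewrite (integral_to_infty_eq _ _ _ (is_RInt_gen_integrand2 a t (x + y) Ha Ht)).
rewrite Rmult_plus_distr_l, !kernel_formula by auto; simpl memory.
assert (0 < sqrt (2 * PI * t))
  by (apply sqrt_lt_R0, Rmult_lt_0_compat; pose proof PI_RGT_0; lra).
field; lra.
Qed.

Theorem theorem2p2 (alpha y : R) (halpha : 0 < alpha) (hy : 0 < y) :
  is_elastic_solution alpha y (u_el alpha y) /\
  (forall x t, 0 <= x -> 0 < t ->
     integrable_to_infty (integrand1 alpha t) (x + y) /\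
     integrable_to_infty (integrand2 alpha t) (x + y) /\
     u_el alpha y x t = u_el_alt alpha y x t).
Proof.
assert (Hu : forall x t, 0 < t -> u_el alpha y x t = wave alpha y 0 (PI / 4) t x)
  by (intros; now apply u_el_wave).
split; [split; [|split; [|split]]|].
- now apply (wave_pde alpha y _ (PI / 4)).
- now apply (wave_initial_value alpha y).
- now apply (wave_initial_velocity alpha y).
- now apply (wave_elastic_bc alpha y _ (PI / 4)).
- intros x t Hx Ht; split; [|split].
  + eexists; now apply is_RInt_gen_integrand1.
  + eexists; now apply is_RInt_gen_integrand2.
  + now rewrite u_el_wave, u_el_alt_wave.
Qed.
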